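(* Let $(N_1,N_2,\lambda_1,\lambda_2)$ be the symmetric Hawkes model with parameters $\mu,\alpha_s,\alpha_c,\beta$ (as defined in the context), and let the price process be $$S_t = S_0+\delta\{N_1(t)-N_2(t)-(N_1(0)-N_2(0))\},\qquad t\ge 0,$$ where $\delta>0$ (tick size) and $S_0>0$ are constants. Assume that the intensities are in the stationary state at time $0$, i.e. $$\lambda_1(0)=\lambda_2(0)=\frac{\mu\beta}{\beta-\alpha_s-\alpha_c}.$$ Put $\xi_1=-\beta-\alpha_c+\alpha_s$. Then for every $t\ge 0$, $$\mathrm{Var}\left(\frac{S_t-S_0}{S_0}\right)=\frac{2\delta^2\lambda_1(0)}{S_0^2\xi_1^2}\left\{\beta^2 t-2(\alpha_s-\alpha_c)\beta\left(\frac{e^{\xi_1 t}-1}{\xi_1}\right)+(\alpha_s-\alpha_c)^2\left(\frac{e^{2\xi_1 t}-1}{2\xi_1}\right)\right\}.$$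
   Context: Symmetric Hawkes model. Parameters: $\mu>0$, $\beta>0$, $\alpha_s,\alpha_c\ge 0$ with $\alpha_s+\alpha_c<\beta$ (equivalently, the branching matrix $\begin{bmatrix}\alpha_s/\beta&\alpha_c/\beta\\ \alpha_c/\beta&\alpha_s/\beta\end{bmatrix}$ has spectral radius less than $1$). $N_1,N_2$ are right-continuous simple counting processes (unit jumps) that almost surely have no common jumps, adapted to a filtration $(\mathcal F_t)_{t\ge0}$, with conditional intensities $\lambda_1,\lambda_2$; that is, $N_i(t)-N_i(0)-\int_0^t\lambda_i(u)\,du$ is an $(\mathcal F_t)$-martingale for $i=1,2$. The intensities are right-continuous with left limits and satisfy, for $t\ge0$ (integrals over $(0,t]$), $$\lambda_1(t)=\mu+(\lambda_1(0)-\mu)e^{-\beta t}+\int_0^t\alpha_s e^{-\beta(t-u)}\,dN_1(u)+\int_0^t\alpha_c e^{-\beta(t-u)}\,dN_2(u),$$ $$\lambda_2(t)=\mu+(\lambda_2(0)-\mu)e^{-\beta t}+\int_0^t\alpha_c e^{-\beta(t-u)}\,dN_1(u)+\int_0^t\alpha_s e^{-\beta(t-u)}\,dN_2(u).$$ ''Stationary state at time $0$'' means precisely that $\lambda_1(0),\lambda_2(0)$ are the deterministic constants given in the claim. *)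

(* Defs.v *)
From HB Require Import structures.
From mathcomp Require Import all_boot all_order all_algebra.
From mathcomp Require Import all_classical all_reals all_analysis.
Set Implicit Arguments.
Unset Strict Implicit.
Unset Printing Implicit Defensive.
Import Order.TTheory GRing.Theory Num.Def Num.Theory.
Import numFieldNormedType.Exports.

Local Open Scope classical_set_scope.
Local Open Scope ring_scope.

(* Time is [0, +oo[, represented by R: every condition below is restricted to
   nonnegative times, and values of processes at negative times are never
   used. *)

Section martingales.
Context {R : realType} {d : measure_display} {T : measurableType d}.
Implicit Types (P : probability T R) (F : R -> set_system T).

Record filtration F : Prop := {
  filtration_sigma : forall t, 0 <= t -> sigma_algebra [set: T] (F t) ;
  filtration_sub : forall t, 0 <= t -> F t `<=` measurable ;
  filtration_mono : forall s t, 0 <= s -> s <= t -> F s `<=` F t }.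

Definition measurable_wrt (G : set_system T) (X : T -> R) : Prop :=
  forall B : set R, measurable B -> G (X @^-1` B).

Definition adapted F (X : R -> T -> R) : Prop :=
  forall t, 0 <= t -> measurable_wrt (F t) (X t).

(* Y is a version of E[X | G] *)
Definition cond_expectation P (G : set_system T) (X Y : T -> R) : Prop :=
  [/\ measurable_wrt G Y, P.-integrable [set: T] (EFin \o Y) &
      forall A, G A ->
        (\int[P]_(w in A) (Y w)%:E = \int[P]_(w in A) (X w)%:E)%E].

Definition martingale P F (M : R -> T -> R) : Prop :=
  [/\ adapted F M,
      forall t, 0 <= t -> P.-integrable [set: T] (EFin \o M t) &
      forall s t, 0 <= s -> s <= t -> cond_expectation P (F s) (M t) (M s)].

End martingales.

(* [lim] is the genuine left limit at t > 0 as soon as the path is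
   nondecreasing on [0, +oo[, as in all uses below. *)
Definition jump {R : realType} {T : Type} (N : R -> T -> nat) (w : T) (t : R)
    : R :=
  (N t w)%:R - lim ((N u w)%:R @[u --> t^'-] : set_system R).

(* N 0 is an arbitrary random natural number: points up to time 0 are
   allowed. *)
Record simple_counting_process (R : realType) (T : Type) := {
  count :> R -> T -> nat ;
  count_nondecreasing : forall w s t,
    0 <= s -> s <= t -> (count s w <= count t w)%N ;
  count_right_continuous : forall w t,
    0 <= t -> (count u w)%:R @[u --> t^'+] --> ((count t w)%:R : R) ;
  count_simple : forall w t,
    0 < t -> jump count w t = 0 \/ jump count w t = 1 }.

Arguments count_nondecreasing {R T} N w {s t} : rename.
Arguments count_right_continuous {R T} N w {t} : rename.
Arguments count_simple {R T} N w {t} : rename.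

Section stieltjes.
Context {R : realType} {T : Type}.
Variables (N : simple_counting_process R T) (w : T).

(* The path of N extended to the whole line by its value at 0; the extension
   does not charge ]-oo, 0]. *)
Definition path_of (u : R) : R := (N (Num.max 0 u) w)%:R.

Let path_of_nondecreasing : nondecreasing path_of.
Proof.
move=> x y xy; rewrite /path_of ler_nat count_nondecreasing//.
- by rewrite le_max lexx.
- by rewrite ge_max !le_max lexx/= xy orbT.
Qed.

Let path_of_right_continuous : right_continuous path_of.
Proof.
move=> x; have [x0|x0] := ltP x 0.
  rewrite {2}/path_of max_l ?ltW//.
  apply: cvg_near_cst; near=> u.
  rewrite /path_of max_l//; near: u.
  exact: nbhs_right_le.
rewrite {2}/path_of max_r//.
apply: cvg_trans; last exact: (count_right_continuous N w x0).
apply: near_eq_cvg; near=> u.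
by rewrite /path_of max_r// (le_trans x0).
Unshelve. all: by end_near. Qed.

HB.instance Definition _ := @isCumulative.Build R _ R path_of
  path_of_nondecreasing path_of_right_continuous.

Definition dN : {measure set (measurableTypeR R) -> \bar R} :=
  lebesgue_stieltjes_measure path_of.

End stieltjes.

Section hawkes.
Context {R : realType} {d : measure_display} {T : measurableType d}.
Implicit Types (P : probability T R) (F : R -> set_system T).
Implicit Types (N : simple_counting_process R T) (lambda : R -> T -> R).

Definition compensated N lambda (t : R) (w : T) : R :=
  (N t w)%:R - (N 0 w)%:R
  - \int[lebesgue_measure]_(u in `[0, t]) lambda u w.

Definition is_intensity P F N lambda : Prop :=
  martingale P F (compensated N lambda).

Definition cadlag (X : R -> T -> R) : Prop := forall w,
  (forall t, 0 <= t -> X u w @[u --> t^'+] --> X t w) /\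
  (forall t, 0 < t -> cvg (X u w @[u --> t^'-])).

Definition intensity_equation (mu beta a1 a2 : R) N1 N2 lambda : Prop :=
  forall w t, 0 <= t ->
  lambda t w =
    mu + (lambda 0 w - mu) * expR (- beta * t)
    + \int[dN N1 w]_(u in `]0, t]) (a1 * expR (- beta * (t - u)))
    + \int[dN N2 w]_(u in `]0, t]) (a2 * expR (- beta * (t - u))).

Definition no_common_jumps P N1 N2 : Prop :=
  {ae P, forall w, forall t, 0 < t -> jump N1 w t = 0 \/ jump N2 w t = 0}.

Record symmetric_hawkes P F (mu alpha_s alpha_c beta : R) N1 N2
    lambda1 lambda2 : Prop := {
  hawkes_filtration : filtration F ;
  hawkes_adapted1 : adapted F (fun t w => (N1 t w)%:R) ;
  hawkes_adapted2 : adapted F (fun t w => (N2 t w)%:R) ;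
  hawkes_no_common_jumps : no_common_jumps P N1 N2 ;
  hawkes_cadlag1 : cadlag lambda1 ;
  hawkes_cadlag2 : cadlag lambda2 ;
  hawkes_intensity1 : is_intensity P F N1 lambda1 ;
  hawkes_intensity2 : is_intensity P F N2 lambda2 ;
  hawkes_equation1 : intensity_equation mu beta alpha_s alpha_c N1 N2 lambda1 ;
  hawkes_equation2 : intensity_equation mu beta alpha_c alpha_s N1 N2 lambda2 }.

Definition price (S0 delta : R) N1 N2 (t : R) (w : T) : R :=
  S0 + delta * ((N1 t w)%:R - (N2 t w)%:R - ((N1 0 w)%:R - (N2 0 w)%:R)).

End hawkes.

(* Main.v *)
(* Put D = N_1 - N_2 (minus its initial value), M the compensated difference,
   a = alpha_s - alpha_c and xi = a - beta.  The intensity equations say that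
   lambda_1 - lambda_2 = a D - beta int (lambda_1 - lambda_2), so pathwise
     D(t) = M(t) + a int_0^t exp (xi (t - s)) M(s) ds,
   and E[D(t)^2] only involves the covariance E[M(s) M(u)] = E[M(min(s,u))^2].
   The same Volterra formula for N_1 + N_2 gives E[N_1 + N_2](t) = 2 lambda_1(0) t
   by stationarity.  Finally E[M(t)^2] = E[(N_1 + N_2)(t)]: the squared
   increments of M along finer and finer grids sum up to the number of jumps;
   a truncation of the square that grows linearly, dominated convergence and
   Fatou's lemma give <= (hence square integrability), and orthogonality of the
   increments with Fatou's lemma gives >=. *)
Require Import Defs.
From HB Require Import structures.
From mathcomp Require Import all_boot all_order all_algebra.
From mathcomp Require Import all_classical all_reals all_analysis.
From mathcomp Require Import measurable_realfun.
From mathcomp Require Import ring lra.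
Import Order.TTheory GRing.Theory Num.Def Num.Theory.
Import numFieldNormedType.Exports.
Set Implicit Arguments.
Unset Strict Implicit.
Unset Printing Implicit Defensive.
Local Open Scope classical_set_scope.
Local Open Scope ring_scope.

(** * Integration of real-valued functions *)

(** The model makes only [compensated] integrable; neither the counts nor the squares of the
    martingales are assumed to be, and this fixes the order of the deductions. The Volterra formula
    for the sum is linear in its martingale, so it yields integrability of N_1 + N_2 as well as its
    mean. This in turn makes the variation of M integrable, being at most the jumps plus the
    integrated intensities, that is, twice the total count minus the compensated sum. Such a
    variation dominates sums of increments times a constant, but not sums of squared increments:
    hence a test function with bounded slope in place of the square. Products M(s) (M(t) - M(s)) can
    be integrated only once square integrability is known, which is why the two inequalities for
    E[M(t)^2] need different arguments. The absence of common jumps acts through one fact: on a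
    short enough interval N_1 and N_2 together jump at most once, so the squared increment of N_1 -
    N_2, its absolute value and the increment of N_1 + N_2 coincide. *)

Section fubini.
Context d1 d2 (T1 : measurableType d1) (T2 : measurableType d2) (R : realType).
Variable m1 : {sigma_finite_measure set T1 -> \bar R}.
Variable m2 : {sigma_finite_measure set T2 -> \bar R}.

(** The function [C] spares the caller any integrability on the product: a pointwise bound on the
    inner integrals of the absolute value suffices by Tonelli. Extending [f] by zero outside the
    rectangle reduces everything to whole spaces. *)
Lemma Rfubini (A : set T1) (B : set T2) (f : T1 -> T2 -> R) (C : T2 -> R) :
  measurable A -> measurable B ->
  measurable_fun setT (fun z : T1 * T2 => f z.1 z.2) ->
  (forall x, A x -> m2.-integrable B (EFin \o f x)) ->
  (forall y, B y -> m1.-integrable A (EFin \o f^~ y)) ->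
  m2.-integrable B (EFin \o C) ->
  (forall y, B y -> (\int[m1]_(x in A) `|f x y| <= C y)) ->
  m1.-integrable A (EFin \o (fun x => \int[m2]_(y in B) f x y)) /\
  \int[m1]_(x in A) (\int[m2]_(y in B) f x y) =
  \int[m2]_(y in B) (\int[m1]_(x in A) f x y).
Proof.
move=> mA mB mf if1 if2 iC fC.
pose g := EFin \o ((fun z => f z.1 z.2) \_ (A `*` B)).
have mg : measurable_fun setT g.
  apply/measurable_EFinP/(measurable_restrictT _ _).1; first exact: measurableX.
  exact: measurable_funTS.
have gF x : (\int[m2]_y g (x, y) =
    ((fun x => (\int[m2]_(y in B) f x y)%:E) \_ A) x)%E.
  rewrite /patch; case: ifPn => xA.
    rewrite /Rintegral fineK; last first.
      by apply: integrable_fin_num => //; apply: if1; rewrite inE in xA.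
    rewrite [RHS]integral_mkcond; apply: eq_integral => y _.
    by rewrite /g /= /patch in_setX/= xA /=; case: ifPn.
  by apply: integral0_eq => y _; rewrite /g /= /patch in_setX/= (negbTE xA).
(* Used with [h] the absolute value for the integrability bound, and with the identity for the final
   exchange; [h 0 = 0] keeps the extension by zero harmless. *)
have gG (h : R -> R) : h 0 = 0 -> forall y,
    (\int[m1]_x (h (fine (g (x, y))))%:E =
    ((fun y => \int[m1]_(x in A) (h (f x y))%:E) \_ B) y)%E.
  move=> h0 y; rewrite /patch; case: ifPn => yB.
    rewrite [RHS]integral_mkcond; apply: eq_integral => x _.
    rewrite /g /= /patch in_setX/= yB andbT.
    by case: ifPn => //= _; rewrite h0.
  apply: integral0_eq => x _.
  by rewrite /g /= /patch in_setX/= (negbTE yB) andbF/= h0.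
have ig : (m1 \x m2)%E.-integrable setT g.
  apply/integrable21ltyP => //.
  have -> : (\int[m2]_y \int[m1]_x `|g (x, y)| =
      \int[m2]_(y in B) \int[m1]_(x in A) `|f x y|%:E)%E.
    rewrite [RHS]integral_mkcond; apply: eq_integral => y _.
    by rewrite -(gG normr)// normr0.
  have /integrableP[mC] := iC; apply: le_lt_trans.
  rewrite integral_mkcond [leRHS]integral_mkcond.
  apply: ge0_le_integral => //.
  - by move=> y _; rewrite /patch; case: ifPn => // _; exact: integral_ge0.
  - have mh : measurable_fun setT (abse \o g) by exact: measurableT_comp.
    have := @measurable_fun_fubini_tonelli_G _ _ _ _ _ m1 (abse \o g).
    rewrite (_ : fubini_G _ _ = (fun y => (\int[m1]_(x in A) (`|f x y|)%:E)%E) \_ B).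
      by move=> h; apply: h => // z; exact: abse_ge0.
    by apply/funext => y; rewrite -(gG normr)// normr0.
  - apply/(measurable_restrictT _ _).1 => //.
    by apply: measurableT_comp.
  - move=> y _; rewrite /patch; case: ifPn => // /set_mem yB.
    have := fC y yB; rewrite /Rintegral -lee_fin fineK; last first.
      apply: integrable_fin_num => //; exact: (integrable_abse (if2 y yB)).
    by move=> /le_trans; apply; rewrite /= lee_fin ler_norm.
have iF : m1.-integrable A (EFin \o (fun x => \int[m2]_(y in B) f x y)).
  have := integrable_fubini_F ig.
  rewrite (_ : fubini_F _ _ = (fun x => (\int[m2]_(y in B) f x y)%:E) \_ A).
    by move=> /(integrable_mkcond _ mA).
  by apply/funext => x; rewrite -gF.
split=> //.
have := Fubini ig; under eq_integral do rewrite gF.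
rewrite -integral_mkcond.
have -> : (\int[m2]_y \int[m1]_x g (x, y) =
    \int[m2]_(y in B) (\int[m1]_(x in A) f x y)%:E)%E.
  rewrite [RHS]integral_mkcond; apply: eq_integral => y _.
  rewrite (gG id)// /patch; case: ifPn => // /set_mem yB.
  by rewrite /Rintegral fineK//; apply: integrable_fin_num => //; exact: if2.
by move=> E; rewrite /Rintegral; congr fine.
Qed.

End fubini.

Section convergence.
Context d (T : measurableType d) (R : realType) (mu : {measure set T -> \bar R}).

Lemma Rdominated_cvg (f_ : nat -> T -> R) (f g : T -> R) :
  (forall n, measurable_fun setT (f_ n)) -> measurable_fun setT f ->
  {ae mu, forall x, f_ ^~ x @ \oo --> f x} ->
  mu.-integrable setT (EFin \o g) ->
  (forall n x, `|f_ n x| <= g x) ->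
  mu.-integrable setT (EFin \o f) /\
  \int[mu]_x f_ n x @[n --> \oo] --> \int[mu]_x f x.
Proof.
move=> mf_ mf cf ig fg.
have [||||h1 _ h2] := @dominated_convergence _ _ _ mu setT measurableT
  (fun n => EFin \o f_ n) (EFin \o f) (EFin \o g) _ _ _ ig.
- by move=> n; exact/measurable_EFinP.
- exact/measurable_EFinP.
- apply: filterS cf => x cx _; apply/fine_cvgP; split; [exact: nearW|exact: cx].
- by apply: aeW => x n _; rewrite lee_fin fg.
split=> //.
by move: h2; rewrite -(fineK (integrable_fin_num _ h1))// => /fine_cvg.
Qed.

Lemma Rfatou (f_ : nat -> T -> R) (f : T -> R) (C : R) :
  (forall n, mu.-integrable setT (EFin \o f_ n)) -> measurable_fun setT f ->
  (forall n x, 0 <= f_ n x) -> (forall x, 0 <= f x) ->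
  {ae mu, forall x, f_ ^~ x @ \oo --> f x} ->
  (forall n, \int[mu]_x f_ n x <= C) ->
  mu.-integrable setT (EFin \o f) /\ \int[mu]_x f x <= C.
Proof.
move=> if_ mf f_0 f0 cf fC.
have H : (\int[mu]_x (f x)%:E <= C%:E)%E.
  have mf_ n : measurable_fun setT (EFin \o f_ n) by exact: measurable_int (if_ n).
  have h := @fatou _ _ _ mu setT measurableT (fun n => EFin \o f_ n) mf_
    (fun n x _ => f_0 n x).
  apply: le_trans (le_trans h _).
    rewrite le_eqVlt; apply/orP; left; apply/eqP.
    apply: ae_eq_integral => //.
    - exact/measurable_EFinP.
    - apply: measurableT_comp => //; apply: measurable_fun_limn_esup => n.
      exact: measurableT_comp.
    apply: filterS cf => x cx _.
    have /cvg_limn_einf_sup[-> _] // : (f_ n x)%:E @[n --> \oo] --> (f x)%:E.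
    by apply/fine_cvgP; split; [exact: nearW|exact: cx].
  rewrite limn_einf_lim; apply: lime_le; first exact: is_cvg_einfs.
  apply: nearW => n; apply: (@le_trans _ _ (\int[mu]_x (f_ n x)%:E)%E).
    by apply: ereal_inf_lbound; exists n => /=.
  rewrite -(fineK (integrable_fin_num _ (if_ n)))// lee_fin.
  exact: fC.
have I : mu.-integrable setT (EFin \o f).
  apply/integrableP; split; first exact/measurable_EFinP.
  rewrite (eq_integral (EFin \o f)).
    by rewrite (le_lt_trans H)// ltry.
  by move=> x _ /=; rewrite ger0_norm.
split=> //; rewrite -lee_fin /Rintegral fineK//.
exact: integrable_fin_num.
Qed.

End convergence.

Section real_integrable.
Context d (T : measurableType d) (R : realType) (mu : {measure set T -> \bar R}).
Variables (D : set T) (mD : measurable D).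
Implicit Types f g : T -> R.

Lemma RintegrableZl k f : mu.-integrable D (EFin \o f) ->
  mu.-integrable D (EFin \o (fun x => k * f x)).
Proof. by move=> h; exact: (@integrableZl _ _ _ mu _ mD k _ h). Qed.

Lemma RintegrableD f g : mu.-integrable D (EFin \o f) ->
  mu.-integrable D (EFin \o g) -> mu.-integrable D (EFin \o (fun x => f x + g x)).
Proof. by move=> h k; exact: (@integrableD _ _ _ mu _ mD _ _ h k). Qed.

Lemma RintegrableB f g : mu.-integrable D (EFin \o f) ->
  mu.-integrable D (EFin \o g) -> mu.-integrable D (EFin \o (fun x => f x - g x)).
Proof. by move=> h k; exact: (@integrableB _ _ _ mu _ mD _ _ h k). Qed.

Lemma le_Rintegrable f g : measurable_fun D f ->
  (forall x, D x -> `|f x| <= g x) -> mu.-integrable D (EFin \o g) ->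
  mu.-integrable D (EFin \o f).
Proof.
move=> mf fg; apply: (le_integrable mD); first exact/measurable_EFinP.
by move=> x Dx; rewrite lee_fin (le_trans (fg x Dx))// ler_norm.
Qed.

Lemma bounded_Rintegrable (K : R) f : (mu D < +oo)%E -> measurable_fun D f ->
  (forall x, D x -> `|f x| <= K) -> mu.-integrable D (EFin \o f).
Proof.
move=> Dfin mf fK; apply: (@le_Rintegrable f (cst K)) => //.
apply: measurable_bounded_integrable => //; exact: bounded_cst.
Qed.

Lemma Rintegrable_sum (n : nat) (f : nat -> T -> R) :
  (forall i, (i < n)%N -> mu.-integrable D (EFin \o f i)) ->
  mu.-integrable D (EFin \o (fun x => \sum_(i < n) f i x)).
Proof.
elim: n => [|n IH] h.
  under eq_fun do rewrite big_ord0; exact: integrable0.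
under eq_fun do rewrite big_ord_recr/=; apply: RintegrableD; last exact: h.
by apply: IH => i ni; apply: h; rewrite ltnS ltnW.
Qed.

Lemma Rintegral_sum (n : nat) (f : nat -> T -> R) :
  (forall i, (i < n)%N -> mu.-integrable D (EFin \o f i)) ->
  \int[mu]_(x in D) (\sum_(i < n) f i x) = \sum_(i < n) \int[mu]_(x in D) f i x.
Proof.
elim: n => [|n IH] h.
  rewrite big_ord0 /Rintegral; under eq_integral do rewrite big_ord0.
  by rewrite integral0.
rewrite big_ord_recr/= -IH; last by move=> i ni; apply: h; rewrite ltnS ltnW.
rewrite -RintegralD//; last 2 first.
- by apply: Rintegrable_sum => i ni; apply: h; rewrite ltnS ltnW.
- exact: h.
by apply: eq_Rintegral => x _; rewrite big_ord_recr.
Qed.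

End real_integrable.

Section process.
Context d (T : measurableType d) (R : realType).
Implicit Type X : R -> T -> R.

(* [X s] is the limit of [X] at the first point of the grid of mesh
   [n.+1%:R^-1] strictly to the right of [s]. *)
Lemma right_continuous_measurable2 X :
  (forall s, 0 <= s -> measurable_fun setT (X s)) ->
  (forall w s, 0 <= s -> X u w @[u --> s^'+] --> X s w) ->
  measurable_fun setT (fun z : measurableTypeR R * T => X (Num.max 0 z.1) z.2).
Proof.
move=> mX rX.
pose k n (s : R) : nat := Num.trunc (Num.max 0 s * n.+1%:R).
pose r n s : R := (k n s).+1%:R / n.+1%:R.
apply: (@measurable_fun_cvg _ _ _ _
  (fun n (z : measurableTypeR R * T) => X (r n z.1) z.2)); last first.
  move=> [s w] _ /=.
  have s0 : 0 <= Num.max 0 s by rewrite le_max lexx.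
  have hr n : Num.max 0 s < r n s <= Num.max 0 s + n.+1%:R^-1.
    have := truncn_itv (mulr_ge0 s0 (ler0n R n.+1)).
    rewrite -/(k n s) => /andP[h1 h2].
    rewrite /r ltr_pdivlMr// h2/= ler_pdivrMr// mulrDl mulVf// -natr1.
    by rewrite lerD2r.
  have := (cvg_at_rightP (X^~ w) (Num.max 0 s) (X (Num.max 0 s) w)).1 (rX w _ s0).
  apply; split; first by move=> n; have /andP[] := hr n.
  apply: (@squeeze_cvgr _ _ _ _ (fun=> Num.max 0 s) (fun n => Num.max 0 s + n.+1%:R^-1)).
  - by apply: nearW => n; have /andP[/ltW -> ->] := hr n.
  - exact: cvg_cst.
  - rewrite -[X in _ --> X]addr0; apply: cvgD; first exact: cvg_cst.
    exact: cvg_harmonic.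
move=> n _ B mB; rewrite setTI.
(* For fixed [n] the sampled process depends on time only through [k n], so the preimage is a
   countable union of rectangles. *)
have -> : (fun z : measurableTypeR R * T => X (r n z.1) z.2) @^-1` B =
    \bigcup_(j in setT) ((k n @^-1` [set j]) `*` (X (j.+1%:R / n.+1%:R) @^-1` B)).
  apply/seteqP; split => [[s w] /= h|[s w] /= [j _ [/= kj]]].
    by exists (k n s) => //; split.
  by rewrite /r kj.
apply: bigcupT_measurable => j; apply: measurableX; last first.
  by rewrite -[X in measurable X]setTI; apply: mX => //; rewrite divr_ge0.
have -> : k n @^-1` [set j] = 
   (fun s : R => Num.max 0 s * n.+1%:R) @^-1` `[j%:R, j.+1%:R[%classic.
  apply/seteqP; split => s /=; rewrite in_itv/= /k.
    move=> <-; apply: truncn_itv; apply: mulr_ge0 => //.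
    by rewrite le_max lexx.
  by move=> /andP[h1 h2]; apply: truncn_def; rewrite h1.
rewrite -[X in measurable X]setTI.
have : measurable_fun setT (fun s : measurableTypeR R => Num.max 0 s * n.+1%:R).
  by apply: measurable_funM => //; apply: measurable_maxr.
by apply => //; exact: measurable_itv.
Qed.

End process.

Lemma right_continuous_measurable (R : realType) (f : R -> R) :
  (forall s, 0 <= s -> f u @[u --> s^'+] --> f s) ->
  measurable_fun setT (fun s : measurableTypeR R => f (Num.max 0 s)).
Proof.
move=> rf.
have m := @right_continuous_measurable2 _ (measurableTypeR R) R (fun s _ => f s)
   (fun _ _ => measurable_cst _) (fun _ => rf).
have := measurableT_comp m (@measurable_pair2 _ _ (measurableTypeR R) (measurableTypeR R) 0).
exact.
Qed.

Section expectation_of_integrals.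
Context d (T : measurableType d) (R : realType) (P : probability T R).
Notation leb := (@lebesgue_measure R).

Lemma expectation_integral (X : R -> T -> R) (phi : R -> R) (t C K : R) :
  (forall s, 0 <= s -> measurable_fun setT (X s)) ->
  (forall w s, 0 <= s -> X u w @[u --> s^'+] --> X s w) ->
  (forall s, 0 <= s <= t -> P.-integrable setT (EFin \o X s)) ->
  (forall s, 0 <= s <= t -> \int[P]_w `|X s w| <= C) ->
  (forall w, leb.-integrable `[0, t] (EFin \o X ^~ w)) ->
  measurable_fun setT phi ->
  (forall s, 0 <= s <= t -> `|phi s| <= K) ->
  P.-integrable setT
    (EFin \o (fun w => \int[leb]_(s in `[0, t]) (phi s * X s w))) /\
  \int[P]_w (\int[leb]_(s in `[0, t]) (phi s * X s w)) =
  \int[leb]_(s in `[0, t]) (phi s * \int[P]_w X s w).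
Proof.
move=> mX rX iX bX pX mphi bphi.
have mt : measurable (`[0, t]%classic : set (measurableTypeR R)).
  exact: measurable_itv.
have max0 s : `[0, t]%classic s -> Num.max 0 s = s.
  by rewrite /= in_itv/= => /andP[s0 _]; rewrite max_r.
have tE s : `[0, t]%classic s -> 0 <= s <= t by rewrite /= in_itv.
(* Fubini asks for joint measurability on the whole product, while nothing is known of [X] at
   negative times; the cutoff freezes it there and changes nothing on [[0, t]]. *)
pose f w (s : measurableTypeR R) := phi (Num.max 0 s) * X (Num.max 0 s) w.
have mf : measurable_fun setT (fun z : T * measurableTypeR R => f z.1 z.2).
  apply: measurable_funM.
    apply: (measurableT_comp mphi).
    exact: (@measurable_maxr _ _ _ _ (cst 0) snd).
  have := right_continuous_measurable2 mX rX => m.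
  exact: (measurableT_comp m (@measurable_swap _ _ _ _)).
have [||||h1 h2] := @Rfubini _ _ _ _ _ P leb setT `[0, t]%classic f (cst (K * C))
  measurableT mt mf.
- move=> w _; apply: (@le_integrable _ _ _ leb _ mt _ (EFin \o (fun s => K * X s w))).
  + apply/measurable_EFinP; apply: measurable_funTS.
    exact: (measurableT_comp mf (measurable_pair1 _)).
  + move=> s st; rewrite /= lee_fin /f max0// !normrM ler_wpM2r//.
    by rewrite (le_trans (bphi _ (tE _ st)))// ler_norm.
  + exact: RintegrableZl.
- move=> s st; rewrite /f max0//.
  by apply: RintegrableZl => //; apply: iX; exact: tE.
- apply: (bounded_Rintegrable mt (K := `|K * C|)) => //=.
  by rewrite /= lebesgue_measure_itv/=; case: ifP => _; rewrite ltry.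
- move=> s st; rewrite /f max0//.
  under eq_Rintegral do rewrite normrM.
  rewrite RintegralZl//; last first.
    by apply: integrable_norm; apply: iX; exact: tE.
  apply: ler_pM => //; [|exact: bphi (tE _ st)|exact: bX (tE _ st)].
  by apply: Rintegral_ge0.
have e w : \int[leb]_(s in `[0, t]) (phi s * X s w) =
    \int[leb]_(s in `[0, t]) f w s.
  by apply: eq_Rintegral => s; rewrite inE => st; rewrite /f max0.
rewrite (funext e : (fun w => _) = _); split => //.
rewrite h2; apply: eq_Rintegral => s; rewrite inE => st; rewrite /f max0//.
by rewrite RintegralZl//; apply: iX; exact: tE.
Qed.

End expectation_of_integrals.

(** * Primitives of exponentials and exchange of integrals over a triangle *)

Section calculus.
Context (R : realType).
Notation leb := (@lebesgue_measure R).

Lemma Rintegral_FTC2 (F f : R -> R) (a b : R) : a <= b -> continuous f ->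
  (forall x : R, is_derive x 1 F (f x)) ->
  \int[leb]_(s in `[a, b]) f s = F b - F a.
Proof.
move=> ab cf dF; move: ab; rewrite le_eqVlt => /predU1P[->|ab].
  by rewrite set_itv1 Rintegral_set1 subrr.
have cF : continuous F.
  move=> x; have dFx : derivable F x 1 by case: (dF x).
  exact: (differentiable_continuous ((derivable1_diffP _ _).1 dFx)).
rewrite /Rintegral (@continuous_FTC2 _ f F a b)//.
- exact: continuous_subspaceT.
- split.
  + by move=> x _; have [] := dF x.
  + exact: cvg_at_right_filter (cF a).
  + exact: cvg_at_left_filter (cF b).
- by move=> x _; rewrite derive1E; apply: derive_val.
Qed.

Lemma is_derive_expRM (c x : R) :
  is_derive x 1 (fun s => expR (c * s)) (c * expR (c * x)).
Proof.
apply: is_derive_eq.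
by rewrite /GRing.scale/= mulr1 mulrC.
Qed.

Lemma continuous_expRM (c : R) : continuous (fun s : R => expR (c * s)).
Proof.
move=> x; apply: (continuous_comp (g := @expR R)); last exact: continuous_expR.
by apply: continuousM; [exact: cst_continuous|exact: cvg_id].
Qed.

Lemma measurable_expRM (c : R) : measurable_fun setT (fun s : measurableTypeR R => expR (c * s)).
Proof. apply: continuous_measurable_fun; exact: continuous_expRM. Qed.

Lemma Rintegral_expRM (c a b : R) : c != 0 -> a <= b ->
  \int[leb]_(s in `[a, b]) expR (c * s) = (expR (c * b) - expR (c * a)) / c.
Proof.
move=> c0 ab.
have h (x : R) : is_derive x 1 (fun s => c^-1 * expR (c * s)) (expR (c * x)).
  have := is_derive_expRM c x => h.
  by apply: is_derive_eq; rewrite /GRing.scale/= mulrA mulVf// mul1r.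
by rewrite (Rintegral_FTC2 ab (@continuous_expRM c) h) -mulrBr mulrC.
Qed.

Lemma fine_lebesgue_itvcc (a b : R) : a <= b -> fine (leb `[a, b]%classic) = b - a.
Proof.
rewrite le_eqVlt => /predU1P[->|ab]; rewrite /= lebesgue_measure_itv/= lte_fin.
  by rewrite ltxx subrr.
by rewrite ab.
Qed.

Lemma lebesgue_itv_lty (a b : R) : (leb `[a, b]%classic < +oo)%E.
Proof. by rewrite /= lebesgue_measure_itv/=; case: ifP => _; rewrite -?EFinB ltry. Qed.

Lemma measurableR_itv (i : interval R) : measurable ([set` i] : set (measurableTypeR R)).
Proof. exact: measurable_itv. Qed.

Lemma Rintegrable_cst_itv (k a b : R) : leb.-integrable `[a, b] (EFin \o (fun=> k)).
Proof.
exact: (bounded_Rintegrable (measurableR_itv _) (lebesgue_itv_lty _ _)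
  (measurable_cst _) (fun _ _ => lexx `|k|)).
Qed.

(** Fubini on the triangle [0 < u <= s <= t]. The measure [nu] is general because it is Lebesgue
    measure in [volterra] and the measure of a counting path in [dN_kernel]; the latter has atoms,
    so the endpoints of the intervals matter. *)
Lemma Rintegral_triangle (nu : {sigma_finite_measure set (measurableTypeR R) -> \bar R})
    (f phi : measurableTypeR R -> R) (t K : R) :
  measurable_fun setT f -> measurable_fun setT phi ->
  nu.-integrable `]0, t] (EFin \o f) ->
  (forall s, 0 <= s <= t -> `|phi s| <= K) ->
  leb.-integrable `[0, t]
    (EFin \o (fun s => phi s * \int[nu]_(u in `]0, s]) f u)) /\
  \int[leb]_(s in `[0, t]) (phi s * \int[nu]_(u in `]0, s]) f u) =
  \int[nu]_(u in `]0, t]) (f u * \int[leb]_(s in `[u, t]) phi s).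
Proof.
move=> mf mphi iF phiK.
have mA := measurableR_itv `[0, t]; have mB := measurableR_itv `]0, t].
(* The triangle is moved into the integrand, so that both variables range over fixed intervals. *)
pose F (s u : measurableTypeR R) : R := if u <= s then phi s * f u else 0.
have mF : measurable_fun setT (fun z : measurableTypeR R * measurableTypeR R => F z.1 z.2).
  apply: measurable_fun_ifT => //.
    exact: measurable_fun_ler.
  by apply: measurable_funM; exact: measurableT_comp.
have FK s u : 0 <= s <= t -> `|F s u| <= K * `|f u|.
  move=> st; rewrite /F; case: ifP => _; last first.
    by rewrite normr0 mulr_ge0// (le_trans _ (phiK _ st)).
  by rewrite normrM ler_wpM2r// phiK.
have AE s : `[0, t]%classic s -> 0 <= s <= t by rewrite /= in_itv.
have [] := @Rfubini _ _ _ _ R leb nu `[0, t]%classic `]0, t]%classic F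
  (fun u => fine (leb `[0, t]%classic) * (K * `|f u|)) mA mB mF.
- move=> s /AE st; apply: (le_Rintegrable mB (g := fun u => K * `|f u|)).
  + exact: measurable_funTS (measurableT_comp mF (measurable_pair1 _)).
  + by move=> u _; exact: FK.
  + by apply: RintegrableZl => //; exact: integrable_norm.
- move=> u _; apply: (bounded_Rintegrable mA (K := K * `|f u|)).
  + exact: lebesgue_itv_lty.
  + exact: measurable_funTS (measurableT_comp mF (measurable_pair2 _)).
  + by move=> s /AE st; exact: FK.
- do 2 apply: RintegrableZl => //; exact: integrable_norm.
- move=> u _; rewrite mulrC -Rintegral_cst//; apply: le_Rintegral => //.
  + apply: integrable_norm; apply: (bounded_Rintegrable mA (K := K * `|f u|)).
    * exact: lebesgue_itv_lty.
    * exact: measurable_funTS (measurableT_comp mF (measurable_pair2 _)).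
    * by move=> s /AE st; exact: FK.
  + apply: (bounded_Rintegrable mA (K := `|K * `|f u| |)) => //.
    exact: lebesgue_itv_lty.
  + by move=> s /AE st; exact: FK.
have F1 s : 0 <= s <= t ->
    \int[nu]_(u in `]0, t]) F s u = phi s * \int[nu]_(u in `]0, s]) f u.
  move=> /andP[s0 st].
  rewrite -RintegralZl//; last first.
    by apply: integrableS iF => //; apply: subset_itvl; rewrite bnd_simp.
  have -> : `]0, s]%classic = `]0, t]%classic `&` [set u | u <= s].
    apply/seteqP; split => u /=; rewrite !in_itv/=.
      by move=> /andP[-> us]/=; rewrite us (le_trans us).
    by move=> [/andP[-> _] ->].
  rewrite Rintegral_mkcondr; apply: eq_Rintegral => u _.
  by rewrite /F /patch mem_setE; case: ifP.
have F2 u : 0 < u <= t ->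
    \int[leb]_(s in `[0, t]) F s u = f u * \int[leb]_(s in `[u, t]) phi s.
  move=> /andP[u0 ut].
  rewrite -RintegralZl//; last first.
    apply: (bounded_Rintegrable (measurableR_itv _) (K := K)).
    - exact: lebesgue_itv_lty.
    - exact: measurable_funTS.
    - by move=> s /=; rewrite in_itv/= => /andP[us st]; rewrite phiK// st (le_trans _ us)// ltW.
  have -> : `[u, t]%classic = `[0, t]%classic `&` [set s | u <= s].
    apply/seteqP; split => s /=; rewrite !in_itv/=.
      by move=> /andP[us ->]; rewrite us (le_trans _ us)// ltW.
    by move=> [/andP[_ ->] ->].
  rewrite Rintegral_mkcondr; apply: eq_Rintegral => s _.
  by rewrite /F /patch mem_setE mulrC; case: ifP.
move=> h1 h2; split.
  apply: eq_integrable h1 => //.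
  by move=> s; rewrite inE => /AE st /=; rewrite F1.
rewrite (@eq_Rintegral _ _ _ leb _ (fun s => \int[nu]_(u in `]0, t]) F s u)); last first.
  by move=> s; rewrite inE => /AE st /=; rewrite F1.
rewrite h2; apply: eq_Rintegral => u; rewrite inE/= in_itv/= => ut.
by rewrite F2.
Qed.

End calculus.

(** * Pathwise equations of the model *)

Section volterra.
Context (R : realType).
Notation leb := (@lebesgue_measure R).

Lemma max0_itv (t s : R) : `[0, t]%classic s -> Num.max 0 s = s.
Proof. by rewrite /= in_itv/= => /andP[s0 _]; rewrite max_r. Qed.

Lemma itv_occ (t s : R) : `]0, t]%classic s -> `[0, t]%classic s /\ s <= t.
Proof. by rewrite /= !in_itv/= => /andP[/ltW -> ->]. Qed.

Lemma right_continuous_bounded_integrable (l : R -> R) (t K : R) :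
  (forall s, 0 <= s -> l u @[u --> s^'+] --> l s) ->
  (forall s, 0 <= s <= t -> `|l s| <= K) ->
  leb.-integrable `[0, t] (EFin \o l).
Proof.
move=> rl lK.
apply: (@eq_integrable _ _ _ leb _ (measurableR_itv _) (EFin \o (fun s => l (Num.max 0 s)))).
  by move=> s; rewrite inE => /max0_itv/= ->.
apply: (bounded_Rintegrable (measurableR_itv _) (K := K)).
- exact: lebesgue_itv_lty.
- exact: measurable_funTS (right_continuous_measurable rl).
- by move=> s st; rewrite (max0_itv st); apply: lK; move: st; rewrite /= in_itv.
Qed.

Lemma Rintegral_itv_oc (f : R -> R) (s : R) : leb.-integrable `]0, s] (EFin \o f) ->
  \int[leb]_(u in `]0, s]) f u = \int[leb]_(u in `[0, s]) f u.
Proof. by move=> h; rewrite Rintegral_itv_obnd_cbnd. Qed.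

Lemma integrable_oc_cc (f : R -> R) (t : R) :
  leb.-integrable `[0, t] (EFin \o f) -> leb.-integrable `]0, t] (EFin \o f).
Proof.
by apply: integrableS => //; apply: subset_itvr; rewrite bnd_simp.
Qed.

(** Variation of constants, by an integrating factor and without derivatives, since [l] is only
    right-continuous. The equation is multiplied by [expR (- xi * s)] and integrated over [[0, t]];
    exchanging the order in the double integral and integrating the exponential explicitly cancels
    the terms in [expR (- xi * s) * l s] and leaves [expR (- xi * t)] times the integral of [l]. *)
Lemma volterra (l m : R -> R) (xi t K : R) : xi != 0 -> 0 <= t ->
  (forall s, 0 <= s -> l u @[u --> s^'+] --> l s) ->
  (forall s, 0 <= s <= t -> `|l s| <= K) ->
  (forall s, 0 <= s <= t -> l s = m s + xi * \int[leb]_(u in `[0, s]) l u) ->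
  \int[leb]_(s in `[0, t]) l s = \int[leb]_(s in `[0, t]) (expR (xi * (t - s)) * m s).
Proof.
move=> xi0 t0 rl lK lE.
have Nxi0 : - xi != 0 by rewrite oppr_eq0.
have il := right_continuous_bounded_integrable rl lK.
have mt := measurableR_itv `[0, t].
have tE s : `[0, t]%classic s -> 0 <= s <= t by rewrite /= in_itv.
pose f s := l (Num.max 0 s).
have fE s : `[0, t]%classic s -> f s = l s by rewrite /f => /max0_itv ->.
have iof : leb.-integrable `]0, t] (EFin \o f).
  apply: (@eq_integrable _ _ _ leb _ (measurableR_itv _) (EFin \o l)).
    move=> s; rewrite inE => st /=; rewrite fE//; move: st.
    by rewrite /= !in_itv/= => /andP[/ltW -> ->].
  apply: integrableS il => //.
  by apply: subset_itvr; rewrite bnd_simp.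
have isf s : 0 <= s <= t -> \int[leb]_(u in `]0, s]) f u = \int[leb]_(u in `[0, s]) l u.
  move=> /andP[s0 st]; rewrite Rintegral_itv_oc; last first.
    apply: integrableS iof => //.
    by apply: subset_itvl; rewrite bnd_simp.
  apply: eq_Rintegral => u; rewrite inE/= in_itv/= => /andP[u0 us].
  by rewrite fE//= in_itv/= u0 (le_trans us).
have phiK s : 0 <= s <= t -> `|expR (- xi * s)| <= expR (`|xi| * t).
  move=> /andP[s0 st]; rewrite ger0_norm ?expR_ge0// ler_expR.
  by rewrite (le_trans (ler_norm _))// normrM normrN (ger0_norm s0) ler_wpM2l.
have [i1 e1] := @Rintegral_triangle R leb f (fun s => expR (- xi * s)) t _
  (right_continuous_measurable rl) (measurable_expRM _) iof phiK.
have ie : leb.-integrable `[0, t] (EFin \o (fun s => expR (- xi * s) * l s)).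
  apply: (le_Rintegrable mt (g := fun s => expR (`|xi| * t) * `|l s|)).
  - apply: measurable_funM.
      exact: measurable_funTS (measurable_expRM _).
    by have /measurable_int/measurable_EFinP := il.
  - move=> s /tE st; rewrite normrM; exact: (ler_wpM2r (normr_ge0 _) (phiK s st)).
  - exact: (RintegrableZl mt _ (integrable_norm il)).
clear phiK.
have iel := RintegrableB mt ie (RintegrableZl mt (expR (- xi * t)) il).
have e2 : \int[leb]_(u in `]0, t]) (f u * \int[leb]_(s in `[u, t]) expR (- xi * s)) =
    (\int[leb]_(u in `[0, t]) (expR (- xi * u) * l u) -
     expR (- xi * t) * \int[leb]_(s in `[0, t]) l s) / xi.
  rewrite -(RintegralZl _ mt il) -(RintegralB mt ie (RintegrableZl mt _ il)).
  rewrite mulrC -(RintegralZl _ mt iel).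
  rewrite -(Rintegral_itv_oc (integrable_oc_cc (RintegrableZl mt _ iel))).
  apply: eq_Rintegral => u; rewrite inE => ut.
  have [ucc ut'] := itv_occ ut.
  rewrite (Rintegral_expRM Nxi0 ut') (fE u ucc).
  by field.
have iem : leb.-integrable `[0, t] (EFin \o (fun s => expR (- xi * s) * m s)).
  have := RintegrableB mt ie (RintegrableZl mt xi i1).
  apply: (eq_integrable mt) => s; rewrite inE => /tE st /=.
  by rewrite (isf s st) (lE s st); congr EFin; ring.
transitivity (expR (xi * t) * \int[leb]_(s in `[0, t]) (expR (- xi * s) * m s)).
  have -> : \int[leb]_(s in `[0, t]) (expR (- xi * s) * m s) =
     \int[leb]_(s in `[0, t]) (expR (- xi * s) * l s) -
     xi * \int[leb]_(s in `[0, t]) (expR (- xi * s) * \int[leb]_(u in `]0, s]) f u).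
    rewrite -(RintegralZl _ mt i1) -(RintegralB mt ie (RintegrableZl mt _ i1)).
    apply: eq_Rintegral => s; rewrite inE => /tE st; rewrite (isf s st) (lE s st).
    by ring.
  rewrite e1 e2.
  transitivity ((expR (xi * t) * expR (- xi * t)) * \int[leb]_(s in `[0, t]) l s).
    by rewrite -expRD mulNr subrr expR0 mul1r.
  by field.
rewrite -(RintegralZl _ mt iem).
by apply: eq_Rintegral => s _; rewrite mulrA -expRD; congr (expR _ * _); ring.
Qed.

End volterra.

Section kernel.
Context (R : realType) (T : Type).
Notation leb := (@lebesgue_measure R).
Variables (N : simple_counting_process R T) (w : T).
Let nu := lebesgue_stieltjes_measure (path_of N w).

Lemma dN_itv (t : R) : 0 <= t -> dN N w `]0, t]%classic = ((N t w)%:R - (N 0 w)%:R)%:E.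
Proof.
move=> t0; transitivity (wlength (path_of N w) `]0, t]%classic).
  exact: (measurable_mu_extE (wlength (path_of N w)) (is_ocitv 0 t)).
by rewrite wlength_itv_bnd// /path_of maxxx (max_r t0).
Qed.

Variables (beta c : R).
Hypothesis beta0 : beta != 0.

Let Y s := \int[dN N w]_(u in `]0, s]) (c * expR (- beta * (s - u))).

Let inu (f : measurableTypeR R -> R) (t K : R) : 0 <= t ->
  measurable_fun setT f -> (forall u, 0 < u <= t -> `|f u| <= K) ->
  nu.-integrable `]0, t] (EFin \o f).
Proof.
move=> t0 mf fK; apply: (bounded_Rintegrable (measurableR_itv _) (K := K)).
- by have := dN_itv t0; rewrite /dN -/nu => ->; rewrite ltry.
- exact: measurable_funTS.
- by move=> u /=; rewrite in_itv/=; exact: fK.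
Qed.

Let mker (s : R) : measurable_fun setT (fun u : measurableTypeR R => c * expR (- beta * (s - u))).
Proof.
apply: measurable_funM => //.
have : measurable_fun setT (fun u : measurableTypeR R => expR (- beta * s) * expR (beta * u)).
  by apply: measurable_funM => //; exact: measurable_expRM.
by apply: eq_measurable_fun => u _; rewrite -expRD; congr expR; ring.
Qed.

Lemma dN_kernel_bound (s : R) : 0 <= s -> 0 <= c -> 0 <= beta ->
  0 <= Y s <= c * ((N s w)%:R - (N 0 w)%:R).
Proof.
move=> s0 c0 b0; apply/andP; split.
  by apply: Rintegral_ge0 => u _; rewrite mulr_ge0 ?expR_ge0.
have -> : c * ((N s w)%:R - (N 0 w)%:R) = \int[dN N w]_(u in `]0, s]) c.
  by rewrite Rintegral_cst; [rewrite dN_itv|exact: measurableR_itv].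
have ker u : 0 < u <= s -> c * expR (- beta * (s - u)) <= c.
  move=> /andP[u0 us]; rewrite ler_piMr// -expR0 ler_expR.
  by rewrite mulNr oppr_le0 mulr_ge0// subr_ge0.
apply: le_Rintegral; [exact: measurableR_itv| | |].
- apply: (inu s0 (mker s) (K := c)) => u us; rewrite ger0_norm ?mulr_ge0 ?expR_ge0//.
  exact: ker.
- by apply: (@inu _ _ c) => // u us; rewrite ger0_norm.
- by move=> u /=; rewrite in_itv/= => /ker.
Qed.

(** Integrated form of [dY = c dN - beta Y ds]: after exchanging the integrals, the time integral of
    the kernel started at [u] is [c / beta * (1 - expR (- beta * (t - u)))]. This removes Stieltjes
    integrals from the rest of the proof. *)
Lemma dN_kernel (t : R) : 0 <= t ->
  leb.-integrable `[0, t] (EFin \o Y) /\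
  Y t = c * ((N t w)%:R - (N 0 w)%:R) - beta * \int[leb]_(s in `[0, t]) Y s.
Proof.
move=> t0.
pose K := expR (`|beta| * t).
have iH s : 0 <= s ->
    nu.-integrable `]0, s] (EFin \o (fun u : measurableTypeR R => expR (beta * u))).
  move=> s0; apply: (@inu _ _ (expR (`|beta| * s))) => //; first exact: measurable_expRM.
  move=> u /andP[u0 ut]; rewrite ger0_norm ?expR_ge0// ler_expR.
  by rewrite (le_trans (ler_norm _))// normrM (gtr0_norm u0) ler_wpM2l.
(* The exponential kernel factors into a function of [s] and a function of [u], which is the shape
   required by [Rintegral_triangle]. *)
have YE s : 0 <= s -> Y s = (c * expR (- beta * s)) * \int[nu]_(u in `]0, s]) expR (beta * u).
  move=> s0; rewrite -(RintegralZl _ (measurableR_itv _) (iH s s0)).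
  by apply: eq_Rintegral => u _; rewrite -mulrA -expRD; congr (_ * expR _); ring.
have phiK s : 0 <= s <= t -> `|c * expR (- beta * s)| <= `|c| * K.
  move=> /andP[s0 st]; rewrite normrM ler_wpM2l// ger0_norm ?expR_ge0// ler_expR.
  by rewrite (le_trans (ler_norm _))// normrM normrN (ger0_norm s0) ler_wpM2l.
have mphi : measurable_fun setT (fun s : measurableTypeR R => c * expR (- beta * s)).
  by apply: measurable_funM => //; exact: measurable_expRM.
have [i1 e1] := @Rintegral_triangle R nu (fun u => expR (beta * u)) _ t _
  (measurable_expRM _) mphi (iH t t0) phiK.
have tE s : `[0, t]%classic s -> 0 <= s by rewrite /= in_itv => /andP[].
split.
  apply: (eq_integrable (measurableR_itv _)) i1 => s; rewrite inE => /tE st.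
  by rewrite /= (YE s st).
have -> : \int[leb]_(s in `[0, t]) Y s =
    \int[leb]_(s in `[0, t]) (c * expR (- beta * s) * \int[nu]_(u in `]0, s]) expR (beta * u)).
  by apply: eq_Rintegral => s; rewrite inE => /tE st /=; rewrite (YE s st).
rewrite e1 {e1 i1 phiK}.
have Nb0 : - beta != 0 by rewrite oppr_eq0.
have ic : nu.-integrable `]0, t] (EFin \o (fun=> c / beta)).
  exact: (@inu _ _ `|c / beta|).
rewrite (@eq_Rintegral _ _ _ nu _
  (fun u => c / beta - expR (- beta * t) * c / beta * expR (beta * u))); last first.
  move=> u; rewrite inE/= in_itv/= => /andP[u0 ut].
  have ip : leb.-integrable `[u, t] (EFin \o (fun s => expR (- beta * s))).
    apply: (bounded_Rintegrable (measurableR_itv _) (K := K)).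
    - exact: lebesgue_itv_lty.
    - exact: measurable_funTS (measurable_expRM _).
    - move=> s /=; rewrite in_itv/= => /andP[us st].
      have s0 : 0 <= s by exact: le_trans (ltW u0) us.
      rewrite ger0_norm ?expR_ge0// ler_expR (le_trans (ler_norm _))//.
      by rewrite normrM normrN ler_wpM2l// ger0_norm.
  rewrite (RintegralZl _ (measurableR_itv _) ip) (Rintegral_expRM Nb0 ut).
  have E : expR (beta * u) * expR (- beta * u) = 1.
    by rewrite -expRD mulNr subrr expR0.
  have -> : expR (beta * u) * (c * ((expR (- beta * t) - expR (- beta * u)) / - beta)) =
      c / beta * (expR (beta * u) * expR (- beta * u)) -
      expR (- beta * t) * c / beta * expR (beta * u).
    by field.
  by rewrite E mulr1.
rewrite (RintegralB (measurableR_itv _) ic (RintegrableZl (measurableR_itv _) _ (iH t t0))).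
rewrite (RintegralZl _ (measurableR_itv _) (iH t t0)) (Rintegral_cst _ (measurableR_itv _)).
rewrite [X in fine X](_ : _ = ((N t w)%:R - (N 0 w)%:R)%:E); last exact: dN_itv.
rewrite (YE t t0) /=.
by field.
Qed.

End kernel.

Section intensity_path.
Context (R : realType) (d : measure_display) (T : measurableType d).
Notation leb := (@lebesgue_measure R).
Variables (N1 N2 : simple_counting_process R T) (lambda : R -> T -> R).
Variables (mu beta a1 a2 : R) (w : T).
Hypothesis beta0 : 0 < beta.
Hypothesis eqn : intensity_equation mu beta a1 a2 N1 N2 lambda.

Let dN1 t := (N1 t w)%:R - (N1 0 w)%:R : R.
Let dN2 t := (N2 t w)%:R - (N2 0 w)%:R : R.
Let I t := \int[leb]_(s in `[0, t]) lambda s w.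

(** Integrated form of [d lambda = beta (mu - lambda) dt + a1 dN1 + a2 dN2], linear in the counts
    and in the integrated intensity. *)
Lemma intensity_integrable_eq (t : R) : 0 <= t ->
  leb.-integrable `[0, t] (EFin \o lambda ^~ w) /\
  lambda t w = lambda 0 w + beta * mu * t + a1 * dN1 t + a2 * dN2 t - beta * I t.
Proof.
move=> t0; have bN0 : beta != 0 by rewrite gt_eqF.
have NbN0 : - beta != 0 by rewrite oppr_eq0.
have mt := measurableR_itv `[0, t].
pose Y1 s := \int[dN N1 w]_(u in `]0, s]) (a1 * expR (- beta * (s - u))).
pose Y2 s := \int[dN N2 w]_(u in `]0, s]) (a2 * expR (- beta * (s - u))).
have [i1 e1] : leb.-integrable `[0, t] (EFin \o Y1) /\
    Y1 t = a1 * dN1 t - beta * \int[leb]_(s in `[0, t]) Y1 s.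
  exact: (dN_kernel N1 w a1 bN0 t0).
have [i2 e2] : leb.-integrable `[0, t] (EFin \o Y2) /\
    Y2 t = a2 * dN2 t - beta * \int[leb]_(s in `[0, t]) Y2 s.
  exact: (dN_kernel N2 w a2 bN0 t0).
have i3 := Rintegrable_cst_itv mu 0 t.
have i4 : leb.-integrable `[0, t] (EFin \o (fun s => expR (- beta * s))).
  apply: (bounded_Rintegrable mt (lebesgue_itv_lty _ _) (K := 1)).
    exact: measurable_funTS (measurable_expRM _).
  move=> s /=; rewrite in_itv/= => /andP[s0 st].
  by rewrite ger0_norm ?expR_ge0// -expR0 ler_expR mulNr oppr_le0 mulr_ge0// ltW.
have i5 := RintegrableZl mt (lambda 0 w - mu) i4.
have i6 := RintegrableD mt i3 i5.
have i7 := RintegrableD mt i6 i1.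
have i8 := RintegrableD mt i7 i2.
have E s : `[0, t]%classic s ->
    lambda s w = mu + (lambda 0 w - mu) * expR (- beta * s) + Y1 s + Y2 s.
  by rewrite /= in_itv/= => /andP[s0 _]; exact: eqn.
split.
  by apply: (eq_integrable mt) i8 => s; rewrite inE => /E /= ->.
have -> : I t = \int[leb]_(s in `[0, t])
     (mu + (lambda 0 w - mu) * expR (- beta * s) + Y1 s + Y2 s).
  by apply: eq_Rintegral => s; rewrite inE => /E ->.
rewrite (RintegralD mt i7 i2) (RintegralD mt i6 i1) (RintegralD mt i3 i5).
rewrite (RintegralZl _ mt i4) (Rintegral_expRM NbN0 t0) (Rintegral_cst _ mt).
have -> : fine (leb `[0, t]%classic) = t by rewrite fine_lebesgue_itvcc// subr0.
rewrite (eqn w t0) -/(Y1 t) -/(Y2 t) mulr0 expR0.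
have alg (x1 x2 l e j1 j2 : R) :
  mu + (l - mu) * e + (a1 * x1 - beta * j1) + (a2 * x2 - beta * j2) =
  l + beta * mu * t + a1 * x1 + a2 * x2 -
  beta * (mu * t + (l - mu) * ((e - 1) / - beta) + j1 + j2) by field.
by rewrite e1 e2; exact: alg.
Qed.

Hypotheses (mu0 : 0 <= mu) (mul : mu <= lambda 0 w) (a10 : 0 <= a1) (a20 : 0 <= a2).

(** Obtained by replacing every decaying exponential by 1. The bound is random and serves path by
    path only; its expectation is never taken. *)
Definition intensity_bound t := lambda 0 w + a1 * dN1 t + a2 * dN2 t.

Lemma intensity_bounds (s t : R) : 0 <= s -> s <= t ->
  0 <= lambda s w <= intensity_bound t.
Proof.
move=> s0 st; rewrite (eqn w s0) /intensity_bound.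
have /andP[y1 z1] := dN_kernel_bound N1 w s0 a10 (ltW beta0).
have /andP[y2 z2] := dN_kernel_bound N2 w s0 a20 (ltW beta0).
set Y1 := Rintegral _ _ _ in y1 z1 *; set Y2 := Rintegral _ _ _ in y2 z2 *.
have e1 : expR (- beta * s) <= 1.
  by rewrite -expR0 ler_expR mulNr oppr_le0 mulr_ge0// ltW.
have e0 : 0 <= expR (- beta * s) by exact: expR_ge0.
set e := expR _ in e0 e1 *; move: e e0 e1 => e e0 e1.
have h : 0 <= (lambda 0 w - mu) * e <= lambda 0 w - mu.
  by rewrite mulr_ge0 ?subr_ge0//= ler_piMr// subr_ge0.
have k1 : a1 * ((N1 s w)%:R - (N1 0 w)%:R) <= a1 * dN1 t.
  by rewrite ler_wpM2l// lerD2r ler_nat count_nondecreasing.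
have k2 : a2 * ((N2 s w)%:R - (N2 0 w)%:R) <= a2 * dN2 t.
  by rewrite ler_wpM2l// lerD2r ler_nat count_nondecreasing.
have alg (m l x p q x1 x2 : R) : 0 <= m -> 0 <= x <= l - m -> 0 <= p -> 0 <= q ->
    p <= x1 -> q <= x2 -> 0 <= m + x + p + q <= l + x1 + x2.
  by move=> ? /andP[? ?] ? ? ? ?; apply/andP; split; lra.
exact: alg mu0 h y1 y2 (le_trans z1 k1) (le_trans z2 k2).
Qed.

(** The integrated intensity is Lipschitz along each path. This gives right continuity of the
    compensated processes and makes the drift negligible in the quadratic variation. *)
Lemma integrated_intensity_increment (s u t : R) : 0 <= s -> s <= u -> u <= t ->
  0 <= I u - I s <= intensity_bound t * (u - s).
Proof.
move=> s0 su ut; have u0 := le_trans s0 su.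
have [iu _] := intensity_integrable_eq u0.
rewrite /I (Rintegral_itvB iu); [|by rewrite bnd_simp|by rewrite bnd_simp].
have iu' : leb.-integrable `]s, u] (EFin \o lambda^~ w).
  by apply: integrableS iu => //; apply: subset_itvr; rewrite bnd_simp.
have msu := measurableR_itv `]s, u].
have sE v : `]s, u]%classic v -> 0 <= v /\ v <= t.
  by rewrite /= in_itv/= => /andP[sv vu]; rewrite (le_trans s0 (ltW sv)) (le_trans vu).
apply/andP; split.
  by apply: Rintegral_ge0 => v /sE[v0 vt]; case/andP: (intensity_bounds v0 vt).
have -> : intensity_bound t * (u - s) = \int[leb]_(v in `]s, u]) (intensity_bound t).
  rewrite (Rintegral_cst _ msu); congr (_ * _).
  by rewrite /= lebesgue_measure_itv/= lte_fin; case: ltgtP su => //= -> _; rewrite subrr.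
apply: (le_Rintegral msu iu').
  apply: (bounded_Rintegrable msu (K := `|intensity_bound t|)) => //.
  by rewrite /= lebesgue_measure_itv/=; case: ifP => _; rewrite -?EFinB ltry.
by move=> v /sE[v0 vt]; case/andP: (intensity_bounds v0 vt).
Qed.

End intensity_path.

Lemma lipschitz_at_right (R : realType) (I : R -> R) (s B : R) :
  (forall u, s <= u -> u <= s + 1 -> 0 <= I u - I s <= B * (u - s)) ->
  I u @[u --> s^'+] --> I s.
Proof.
move=> h; apply: (@squeeze_cvgr _ _ _ _ (fun=> I s) (fun u => I s + B * (u - s))).
- near=> u; have us : s <= u by near: u; exact: nbhs_right_ge.
  have us1 : u <= s + 1 by near: u; apply: nbhs_right_le; rewrite ltrDl.
  by have /andP[h1 h2] := h u us us1; rewrite -subr_ge0 h1/= -lerBlDl.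
- exact: cvg_cst.
- rewrite -[X in _ --> X]addr0 -[X in _ --> _ + X](mulr0 B) -(subrr s).
  apply: cvg_at_right_filter; apply: cvgD; first exact: cvg_cst.
  by apply: cvgM; [exact: cvg_cst|apply: cvgB; [exact: cvg_id|exact: cvg_cst]].
Unshelve. all: by end_near. Qed.

Section hawkes_path.
Context (R : realType) (d : measure_display) (T : measurableType d).
Notation leb := (@lebesgue_measure R).
Variables (N1 N2 : simple_counting_process R T) (lambda1 lambda2 : R -> T -> R).
Variables (mu alpha_s alpha_c beta l0 : R).
Hypotheses (beta0 : 0 < beta) (mu0 : 0 <= mu) (mul0 : mu <= l0).
Hypotheses (as0 : 0 <= alpha_s) (ac0 : 0 <= alpha_c).
Hypothesis eq1 : intensity_equation mu beta alpha_s alpha_c N1 N2 lambda1.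
Hypothesis eq2 : intensity_equation mu beta alpha_c alpha_s N1 N2 lambda2.
Hypotheses (cad1 : cadlag lambda1) (cad2 : cadlag lambda2).
Hypotheses (l10 : forall w, lambda1 0 w = l0) (l20 : forall w, lambda2 0 w = l0).

Lemma count_sub_right_continuous (N : simple_counting_process R T) w s : 0 <= s ->
  (N u w)%:R - (N 0 w)%:R @[u --> s^'+] --> ((N s w)%:R - (N 0 w)%:R : R).
Proof.
by move=> s0; apply: cvgB; [exact: (count_right_continuous N w s0)|exact: cvg_cst].
Qed.

Let mul1 w : mu <= lambda1 0 w. Proof. by rewrite l10. Qed.
Let mul2 w : mu <= lambda2 0 w. Proof. by rewrite l20. Qed.

Lemma compensated1_right_continuous w s : 0 <= s ->
  compensated N1 lambda1 u w @[u --> s^'+] --> compensated N1 lambda1 s w.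
Proof.
move=> s0; apply: cvgB; first exact: count_sub_right_continuous.
apply: (@lipschitz_at_right _ (fun u => \int[leb]_(v in `[0, u]) lambda1 v w)) => u su us1.
exact: (integrated_intensity_increment beta0 eq1 mu0 (mul1 w) as0 ac0 s0 su us1).
Qed.

Lemma compensated2_right_continuous w s : 0 <= s ->
  compensated N2 lambda2 u w @[u --> s^'+] --> compensated N2 lambda2 s w.
Proof.
move=> s0; apply: cvgB; first exact: count_sub_right_continuous.
apply: (@lipschitz_at_right _ (fun u => \int[leb]_(v in `[0, u]) lambda2 v w)) => u su us1.
exact: (integrated_intensity_increment beta0 eq2 mu0 (mul2 w) ac0 as0 s0 su us1).
Qed.

(* [sg = 1] is the total count and [sg = -1] the difference; the hypothesis
   expressing stationarity is void in the latter case. *)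
Lemma signed_count_representation (sg t : R) w : sg ^+ 2 = 1 -> 0 <= t ->
  let a := alpha_s + sg * alpha_c in
  let xi := a - beta in
  xi != 0 -> (1 + sg) * (beta * mu + xi * l0) = 0 ->
  let M s w := compensated N1 lambda1 s w + sg * compensated N2 lambda2 s w in
  ((N1 t w)%:R - (N1 0 w)%:R) + sg * ((N2 t w)%:R - (N2 0 w)%:R) =
  M t w + (1 + sg) * l0 * t +
  \int[leb]_(s in `[0, t]) (a * expR (xi * (t - s)) * M s w).
Proof.
move=> sg2 t0 a xi xi0 stat M.
(* Centring at the initial value of [lambda1 + sg * lambda2] removes the constant and linear terms,
   so that the Volterra equation for [l] is driven by [M] alone. *)
pose l s := lambda1 s w + sg * lambda2 s w - (1 + sg) * l0.
pose I1 s := \int[leb]_(v in `[0, s]) lambda1 v w.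
pose I2 s := \int[leb]_(v in `[0, s]) lambda2 v w.
have lI s : 0 <= s -> leb.-integrable `[0, s] (EFin \o l) /\
    \int[leb]_(u in `[0, s]) l u = I1 s + sg * I2 s - (1 + sg) * l0 * s.
  move=> s0; have ms := measurableR_itv `[0, s].
  have [i1 _] := intensity_integrable_eq w beta0 eq1 s0.
  have [i2 _] := intensity_integrable_eq w beta0 eq2 s0.
  have i3 := RintegrableD ms i1 (RintegrableZl ms sg i2).
  have i4 := Rintegrable_cst_itv ((1 + sg) * l0) 0 s.
  split; first exact: (RintegrableB ms i3 i4).
  rewrite (RintegralB ms i3 i4) (RintegralD ms i1 (RintegrableZl ms sg i2)).
  rewrite (RintegralZl _ ms i2) (Rintegral_cst _ ms); congr (_ - _ * _).
  by rewrite fine_lebesgue_itvcc// subr0.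
(* Each count is its compensated part plus the integrated intensity; the latter contributes [a] to
   the coefficient [- beta], whence [xi = a - beta]. *)
have lE s : 0 <= s <= t -> l s = a * M s w + xi * \int[leb]_(u in `[0, s]) l u.
  move=> /andP[s0 st]; have [_ ->] := lI s s0.
  have [_ e1] := intensity_integrable_eq w beta0 eq1 s0.
  have [_ e2] := intensity_integrable_eq w beta0 eq2 s0.
  rewrite /l e1 e2 /M /compensated -/(I1 s) -/(I2 s) l10 l20 /xi /a.
  have alg (n1 n2 i1 i2 : R) :
    l0 + beta * mu * s + alpha_s * n1 + alpha_c * n2 - beta * i1 +
      sg * (l0 + beta * mu * s + alpha_c * n1 + alpha_s * n2 - beta * i2) - (1 + sg) * l0 =
    (alpha_s + sg * alpha_c) * (n1 - i1 + sg * (n2 - i2)) +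
      (alpha_s + sg * alpha_c - beta) * (i1 + sg * i2 - (1 + sg) * l0 * s).
    apply/eqP; rewrite -subr_eq0; apply/eqP.
    (* The defect of the identity splits into one multiple of the stationarity relation and one
       multiple of [1 - sg ^+ 2]. *)
    transitivity ((1 + sg) * (beta * mu + xi * l0) * s + (1 - sg ^+ 2) * alpha_c * n2).
      by rewrite /xi /a; ring.
    by rewrite stat sg2 subrr !mul0r addr0.
  exact: alg.
have rl s : 0 <= s -> l u @[u --> s^'+] --> l s.
  move=> s0; apply: cvgB; last exact: cvg_cst.
  apply: cvgD; first exact: (cad1 w).1.
  by apply: cvgM; [exact: cvg_cst|exact: (cad2 w).1].
pose B1 := intensity_bound N1 N2 lambda1 alpha_s alpha_c w t.
pose B2 := intensity_bound N1 N2 lambda2 alpha_c alpha_s w t.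
have lK s : 0 <= s <= t -> `|l s| <= B1 + `|sg| * B2 + `|(1 + sg) * l0|.
  move=> /andP[s0 st].
  have /andP[p1 q1] := intensity_bounds beta0 eq1 mu0 (mul1 w) as0 ac0 s0 st.
  have /andP[p2 q2] := intensity_bounds beta0 eq2 mu0 (mul2 w) ac0 as0 s0 st.
  rewrite (le_trans (ler_normB _ _))// lerD2r (le_trans (ler_normD _ _))//.
  by rewrite normrM (ger0_norm p1) (ger0_norm p2) lerD// ler_wpM2l.
have V := volterra xi0 t0 rl lK lE.
have [_ It] := lI t t0.
have -> : \int[leb]_(s in `[0, t]) (a * expR (xi * (t - s)) * M s w) =
    I1 t + sg * I2 t - (1 + sg) * l0 * t.
  rewrite -It V; apply: eq_Rintegral => s _; ring.
rewrite /M /compensated -/(I1 t) -/(I2 t); ring.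
Qed.

End hawkes_path.

(** * Martingale orthogonality *)

Definition clamp (R : realType) (K x : R) : R := Num.max (- K) (Num.min K x).

Lemma clamp_measurable (R : realType) (K : R) : measurable_fun setT (clamp K).
Proof. by apply: measurable_maxr => //; exact: measurable_minr. Qed.

Lemma clamp_norm (R : realType) (K x : R) : 0 <= K -> `|clamp K x| <= K.
Proof.
move=> K0; rewrite ler_norml /clamp le_max lexx/= ge_max ge_min lexx/= andbT.
by rewrite (le_trans _ K0)// oppr_le0.
Qed.

Lemma clamp_id (R : realType) (K x : R) : `|x| <= K -> clamp K x = x.
Proof. by rewrite ler_norml /clamp => /andP[h1 h2]; rewrite min_r// max_r. Qed.

Lemma clamp_norm_le (R : realType) (K x : R) : 0 <= K -> `|clamp K x| <= `|x|.
Proof.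
move=> K0; have [/clamp_id->//|xK] := leP `|x| K.
by rewrite (le_trans (clamp_norm _ K0))// ltW.
Qed.

Section sub_sigma_algebra.
Context (R : realType) (d : measure_display) (T : measurableType d).
Variables (P : probability T R) (G : set_system T).
Hypotheses (sG : sigma_algebra [set: T] G) (Gm : G `<=` measurable).

Lemma measurable_wrt_measurable (X : T -> R) : measurable_wrt G X -> measurable_fun setT X.
Proof. by move=> h _ B mB; rewrite setTI; exact/Gm/h. Qed.

(** A sigma-algebra generates itself, so [G]-measurability becomes measurability on a genuine
    measurable type, where closure under sums and products is available. *)
Lemma measurable_wrtP (X : T -> R) :
  measurable_wrt G X <-> measurable_fun setT (X : g_sigma_algebraType G -> R).
Proof.
have GE : <<s G >> = G by exact: sigma_algebra_id.
split=> h.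
  by move=> _ B mB; rewrite setTI /measurable/= GE; exact: h.
by move=> B mB; have := h measurableT B mB; rewrite setTI /measurable/= GE.
Qed.

Lemma measurable_wrtD (X Y : T -> R) (k : R) : measurable_wrt G X -> measurable_wrt G Y ->
  measurable_wrt G (fun w => X w + k * Y w).
Proof.
move=> /measurable_wrtP mX /measurable_wrtP mY; apply/measurable_wrtP.
by apply: measurable_funD => //; exact: measurable_funM.
Qed.

Lemma measurable_wrt_comp (h : R -> R) (X : T -> R) :
  measurable_fun setT h -> measurable_wrt G X -> measurable_wrt G (h \o X).
Proof.
move=> mh mX B mB; rewrite comp_preimage; apply: mX.
by rewrite -[X in measurable X]setTI; exact: mh.
Qed.

Variable (D : T -> R).
Hypothesis iD : P.-integrable setT (EFin \o D).
Hypothesis D0 : forall A, G A -> \int[P]_(w in A) D w = 0.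

(* [Z] is uniformly approximated by rounding it down to multiples of
   [n.+1%:R^-1]; its level sets are in [G]. *)
Lemma bounded_integral_mul_eq0 (Z : T -> R) (K : R) : measurable_wrt G Z ->
  (forall w, `|Z w| <= K) -> \int[P]_w (Z w * D w) = 0.
Proof.
move=> mZ ZK.
have mZ' := measurable_wrt_measurable mZ.
have mD : measurable_fun setT D by move/measurable_int/measurable_EFinP : iD.
have iZD : P.-integrable setT (EFin \o (fun w => Z w * D w)).
  apply: (le_Rintegrable measurableT (g := fun w => K * `|D w|)).
  - exact: measurable_funM.
  - by move=> w _; rewrite normrM ler_wpM2r.
  - exact: (RintegrableZl measurableT _ (integrable_norm iD)).
apply/eqP; rewrite -normr_le0; apply/ler_addgt0Pl => e e0; rewrite addr0.
pose J := \int[P]_w `|D w|.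
have J0 : 0 <= J by apply: Rintegral_ge0.
(* Rounding with step [n.+1%:R^-1] costs at most [J / n.+1%:R] in the integral, which this choice
   puts below [e]. *)
have [n nJ] : exists n : nat, J / e < n.+1%:R.
  exists (Num.trunc (J / e)); have /andP[_] // := truncn_itv (divr_ge0 J0 (ltW e0)).
(* The shift by [K] makes the truncated number nonnegative, and the bound on [Z] leaves finitely
   many levels. *)
pose q w := Num.trunc ((Z w + K) * n.+1%:R).
have ZK0 w : 0 <= Z w + K by have := ZK w; rewrite ler_norml -lerBlDr sub0r => /andP[].
have qP w : (q w)%:R <= (Z w + K) * n.+1%:R < (q w).+1%:R.
  exact: truncn_itv (mulr_ge0 (ZK0 w) (ler0n _ _)).
pose m := (Num.trunc ((K + K) * n.+1%:R)).+1.
have qm w : (q w < m)%N.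
  rewrite ltnS; apply: le_truncn.
  by rewrite ler_wpM2r// lerD2r; have := ZK w; rewrite ler_norml => /andP[].
pose A j := q @^-1` [set j].
have GA j : G (A j).
  have -> : A j = Z @^-1` `[j%:R / n.+1%:R - K, j.+1%:R / n.+1%:R - K[%classic.
    apply/seteqP; split => w /=; rewrite in_itv/=.
      move=> <-; have := qP w.
      by rewrite lerBlDr ltrBrDr ler_pdivrMr// ltr_pdivlMr.
    rewrite lerBlDr ltrBrDr ler_pdivrMr// ltr_pdivlMr// => h.
    exact: truncn_def.
  by apply: mZ; exact: measurable_itv.
pose c j : R := j%:R / n.+1%:R - K.
have iDA j : P.-integrable setT (EFin \o (D \_ (A j))).
  have mAj : measurable (A j) by exact: Gm.
  rewrite -restrict_EFin; apply/(integrable_mkcond _ mAj).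
  exact: (integrableS measurableT mAj (@subsetT _ _) iD).
have iA j : P.-integrable setT (EFin \o (fun w => c j * (D \_ (A j)) w)).
  exact: (RintegrableZl measurableT).
pose Zn w := c (q w).
have ZnE w : Zn w * D w = \sum_(j < m) c j * (D \_ (A j)) w.
  rewrite (bigD1 (Ordinal (qm w)))//= big1 ?addr0.
    by rewrite /patch ifT// inE.
  move=> j jq; rewrite /patch ifF ?mulr0//; apply/negbTE; rewrite notin_setE/= => e'.
  by move/eqP: jq; apply; apply: val_inj; rewrite /= -e'.
pose f j w := c j * (D \_ (A j)) w.
have i1 := @Rintegrable_sum _ _ _ P _ measurableT m f (fun j _ => iA j).
have iZn : P.-integrable setT (EFin \o (fun w => Zn w * D w)).
  by apply: (eq_integrable measurableT) i1 => w _ /=; rewrite ZnE.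
have Zn0 : \int[P]_w (Zn w * D w) = 0.
  under eq_Rintegral do rewrite ZnE.
  rewrite (@Rintegral_sum _ _ _ P _ measurableT m f (fun j _ => iA j)).
  rewrite big1// => j _; rewrite (RintegralZl _ measurableT (iDA j)).
  by rewrite -Rintegral_mkcond D0// mulr0.
rewrite -(subr0 (Rintegral _ _ _)) -Zn0 -(RintegralB measurableT iZD iZn).
apply: le_trans (le_normr_Rintegral measurableT (RintegrableB measurableT iZD iZn)) _.
apply: (@le_trans _ _ (\int[P]_w (n.+1%:R^-1 * `|D w|))); last first.
  rewrite (RintegralZl _ measurableT (integrable_norm iD)) -/J.
  by rewrite mulrC ler_pdivrMr// mulrC -ler_pdivrMr// ltW.
apply: (le_Rintegral measurableT).
- exact: (integrable_norm (RintegrableB measurableT iZD iZn)).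
- exact: (RintegrableZl measurableT _ (integrable_norm iD)).
move=> w _; rewrite -mulrBl normrM ler_wpM2r//.
have /andP[h1 h2] := qP w.
rewrite ler_norml /Zn /c opprB addrA; apply/andP; split.
  apply: (@le_trans _ _ 0); first by rewrite oppr_le0.
  by rewrite subr_ge0 ler_pdivrMr.
by rewrite lerBlDr -[X in _ <= X + _]mul1r -mulrDl [1 + _]addrC natr1 ler_pdivlMr// ltW.
Qed.

(** Clamping [Z] at level [n] keeps it [G]-measurable and reduces to the bounded case; [|Z * D|]
    dominates all the clamped products. *)
Lemma integral_mul_eq0 (Z : T -> R) : measurable_wrt G Z ->
  P.-integrable setT (EFin \o (fun w => Z w * D w)) -> \int[P]_w (Z w * D w) = 0.
Proof.
move=> mZ iZD.
have mZ' := measurable_wrt_measurable mZ.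
have mD : measurable_fun setT D by move/measurable_int/measurable_EFinP : iD.
have mZn n : measurable_wrt G (clamp n%:R \o Z).
  by apply: measurable_wrt_comp => //; exact: clamp_measurable.
have [|||||_] := @Rdominated_cvg _ _ _ P (fun n w => clamp n%:R (Z w) * D w)
  (fun w => Z w * D w) (fun w => `|Z w * D w|).
- by move=> n; apply: measurable_funM => //; exact: (measurable_wrt_measurable (mZn n)).
- exact: measurable_funM.
- apply: aeW => w; apply: cvg_near_cst.
  near=> n; rewrite clamp_id//; near: n.
  exact: nbhs_infty_ger.
- exact: integrable_norm.
- by move=> n w; rewrite !normrM ler_wpM2r// clamp_norm_le.
have -> : (fun n : nat => \int[P]_w (clamp n%:R (Z w) * D w)) = (fun=> 0).
  apply/funext => n; apply: (bounded_integral_mul_eq0 (K := n%:R) (mZn n)) => w.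
  by rewrite /= clamp_norm.
by move/cvg_lim => <-//; rewrite lim_cst.
Unshelve. all: by end_near. Qed.

End sub_sigma_algebra.

(** * Quadratic variation along grids *)

Section count_path.
Context (R : realType) (T : Type) (N : simple_counting_process R T) (w : T).

(** Natural numbers at distance less than 1 are equal, so right continuity with tolerance 1 is
    already constancy. *)
Lemma count_right_constant (s : R) : 0 <= s ->
  exists2 e : R, 0 < e & forall u, s <= u -> u < s + e -> N u w = N s w.
Proof.
move=> s0; have /cvgrPdist_lt/(_ _ ltr01) := count_right_continuous N w s0.
move=> [e /= e0 he]; exists e => // u; rewrite le_eqVlt => /predU1P[->//|su us].
have := he u; rewrite /= distrC ger0_norm ?subr_ge0 ?(ltW su)// ltrBlDl => /(_ us su).
have Nsu : (N s w <= N u w)%N by exact: count_nondecreasing (ltW su).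
rewrite distrC ger0_norm ?subr_ge0 ?ler_nat// -natrB// -[1]/(1%:R) ltr_nat ltnS leqn0 subn_eq0.
by move=> us'; apply/eqP; rewrite eqn_leq us' Nsu.
Qed.

(** [L] is the largest value taken before [s]; it exists since [N s w] bounds these values. After a
    time [u0] where it is attained monotonicity forces constancy, so [e = s - u0] works and [L] is
    the left limit appearing in [jump]. *)
Lemma count_left_constant (s : R) : 0 < s -> exists (e : R) (L : nat),
  [/\ 0 < e, forall u, 0 <= u -> s - e < u -> u < s -> N u w = L,
      (L <= N s w)%N & (N s w)%:R - L%:R = jump N w s].
Proof.
move=> s0.
pose Q n := `[< exists2 u : R, 0 <= u < s & N u w = n >].
have exQ : exists n, Q n.
  by exists (N 0 w); apply/asboolP; exists 0; rewrite ?lexx.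
have bQ n : Q n -> (n <= N s w)%N.
  by move=> /asboolP[u /andP[u0 us] <-]; exact: count_nondecreasing (ltW us).
case: (ex_maxnP exQ bQ) => L /asboolP[u0 /andP[u00 u0s] Lu0] maxL.
have LN : (L <= N s w)%N by rewrite -Lu0; exact: count_nondecreasing (ltW u0s).
have cst u : u0 < u -> u < s -> N u w = L.
  move=> u0u us; apply/eqP; rewrite eqn_leq; apply/andP; split.
    by apply: maxL; apply/asboolP; exists u => //; rewrite us (le_trans u00 (ltW u0u)).
  by rewrite -Lu0; exact: count_nondecreasing (ltW u0u).
exists (s - u0), L; split => //.
- by rewrite subr_gt0.
- by move=> u _; rewrite opprB addrC subrK; exact: cst.
- rewrite /jump; congr (_ - _); apply/esym/cvg_lim => //.
  apply: cvg_near_cst; near=> u; congr (_%:R); apply: cst.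
    by near: u; exact: nbhs_left_gt.
  by near: u; exact: nbhs_left_lt.
Unshelve. all: by end_near. Qed.

End count_path.

(** Around each time both paths are constant on either side, and at the time itself only one of them
    may jump, by at most 1. Compactness of [[0, t]] turns the local radii into one [r], a Lebesgue
    number. *)
Lemma isolated_jumps (R : realType) (T : Type) (N1 N2 : simple_counting_process R T)
    (w : T) (t : R) :
  (forall s, 0 < s -> jump N1 w s = 0 \/ jump N2 w s = 0) ->
  exists2 r : R, 0 < r & forall u v, 0 <= u -> u <= v -> v <= t -> v - u < r ->
    (N1 v w + N2 v w <= N1 u w + N2 u w + 1)%N.
Proof.
move=> noc.
have loc (s : R) : 0 <= s -> exists2 e : R, 0 < e &
    forall u v, 0 <= u -> u <= v -> s - e < u -> v < s + e ->
    (N1 v w + N2 v w <= N1 u w + N2 u w + 1)%N.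
  move=> s0; have [e1 e10 r1] := count_right_constant N1 w s0.
  have [e2 e20 r2] := count_right_constant N2 w s0.
  have right e u v : e <= e1 -> e <= e2 -> s <= u -> u <= v -> v < s + e ->
      (N1 v w + N2 v w <= N1 u w + N2 u w + 1)%N.
    move=> ee1 ee2 su uv vs.
    have v1 : v < s + e1 by rewrite (lt_le_trans vs)// lerD2l.
    have v2 : v < s + e2 by rewrite (lt_le_trans vs)// lerD2l.
    rewrite (r1 v)// ?(le_trans su)// (r2 v)// ?(le_trans su)//.
    by rewrite (r1 u)// ?(le_lt_trans uv)// (r2 u)// ?(le_lt_trans uv)// leq_addr.
  (* At time 0 there is nothing to the left and constancy to the right suffices. *)
  move: s0; rewrite le_eqVlt => /predU1P[s0|s0].
    exists (Num.min e1 e2); first by rewrite lt_min e10.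
    move=> u v u0 uv _; apply: right => //; rewrite ?ge_min ?lexx ?orbT//.
    by rewrite -s0.
  have [f1 [L1 [f10 l1 LN1 j1]]] := count_left_constant N1 w s0.
  have [f2 [L2 [f20 l2 LN2 j2]]] := count_left_constant N2 w s0.
  pose e := Num.min (Num.min e1 e2) (Num.min f1 f2).
  have ee1 : e <= e1 by rewrite !ge_min lexx.
  have ee2 : e <= e2 by rewrite !ge_min lexx ?orbT.
  have ef1 : e <= f1 by rewrite !ge_min lexx ?orbT.
  have ef2 : e <= f2 by rewrite !ge_min lexx ?orbT.
  exists e; first by rewrite !lt_min e10 e20 f10 f20.
  move=> u v u0 uv su vs.
  have [su'|us] := leP s u; first exact: (right e).
  rewrite (l1 u)//; last by rewrite (le_lt_trans _ su)// lerB.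
  rewrite (l2 u)//; last by rewrite (le_lt_trans _ su)// lerB.
  have [sv|vs'] := leP s v; last first.
    rewrite (l1 v) ?(l2 v) ?leq_addr// ?(le_trans u0)// (lt_le_trans _ uv)//.
      by rewrite (le_lt_trans _ su)// lerB.
    by rewrite (le_lt_trans _ su)// lerB.
  rewrite (r1 v)// ?(lt_le_trans vs) ?lerD2l// (r2 v)// ?(lt_le_trans vs) ?lerD2l//.
  have natj (n l : nat) : (l <= n)%N -> (n%:R - l%:R = 0 :> R \/ n%:R - l%:R = 1 :> R) ->
      (n <= l.+1)%N.
    move=> ln [/eqP|/eqP]; first by rewrite subr_eq0 eqr_nat => /eqP ->.
    by rewrite subr_eq -[1]/(1%:R) -natrD eqr_nat add1n => /eqP ->.
  have n1 := natj _ _ LN1; rewrite j1 in n1.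
  have n2 := natj _ _ LN2; rewrite j2 in n2.
  have {}n1 := n1 (count_simple N1 w s0); have {}n2 := n2 (count_simple N2 w s0).
  have [z|z] := noc s s0.
    have : N1 s w = L1 by apply/eqP; rewrite -(eqr_nat R) -subr_eq0 j1 z.
    by move=> ->; rewrite -addnA leq_add2l addn1.
  have : N2 s w = L2 by apply/eqP; rewrite -(eqr_nat R) -subr_eq0 j2 z.
  by move=> ->; rewrite addnAC leq_add2r addn1.
(* The radius [r] ranges along the filter [0^'+], so the covering property yields radii valid for
   all [u] in the segment at once. Locally, [u] within [e / 2] of [s] and [v - u < e / 2] keep [v]
   within [e]. *)
have := @segment_compact R 0 t => /compact_near_coveringP.
move=> /(_ R (0^'+) (fun r u => 0 <= u -> forall v, u <= v -> v - u < r ->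
  (N1 v w + N2 v w <= N1 u w + N2 u w + 1)%N)) /(_ _).
case.
  move=> s /=; rewrite in_itv/= => /andP[s0 st].
  have [e e0 he] := loc s s0.
  near=> u r => /= u0 v uv vur.
  have us : `|s - u| < e / 2 by near: u; apply: nbhsx_ballx; exact: divr_gt0.
  have re : r < e / 2 by near: r; apply: nbhs_right_lt; exact: divr_gt0.
  move: us; rewrite ltr_norml => /andP[h1 h2].
  apply: he => //; first lra.
  lra.
(* The conclusion holds for every positive radius below [r0], so a definite one is chosen. *)
move=> r0 /= r00 hr; exists (r0 / 2); first exact: divr_gt0.
move=> u v u0 uv vt uvr; apply: (hr (r0 / 2)) => //=.
- by rewrite sub0r normrN gtr0_norm ?divr_gt0// ltr_pdivrMr// ltr_pMr// ltr1n.
- exact: divr_gt0.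
- by rewrite in_itv/= u0 (le_trans uv).
Unshelve. all: by end_near. Qed.

Section grid.
Context (R : realType).
Implicit Types (f M D V I : R -> R) (t : R).

Definition grid t m k : R := t * k%:R / m.+1%:R.

Lemma grid0 t m : grid t m 0 = 0. Proof. by rewrite /grid mulr0 mul0r. Qed.

Lemma grid_last t m : grid t m m.+1 = t. Proof. by rewrite /grid mulfK. Qed.

Lemma grid_step t m k : grid t m k.+1 - grid t m k = t / m.+1%:R.
Proof. by rewrite /grid -mulrBl -mulrBr -natrB// subSnn mulr1. Qed.

Lemma grid_itv t m k : 0 <= t -> (k <= m)%N ->
  [/\ 0 <= grid t m k, grid t m k <= grid t m k.+1 & grid t m k.+1 <= t].
Proof.
move=> t0 km; split.
- by rewrite /grid !mulr_ge0// invr_ge0.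
- by rewrite -subr_ge0 grid_step divr_ge0.
- by rewrite /grid ler_pdivrMr// ler_wpM2l// ler_nat.
Qed.

Definition incr t m f k := f (grid t m k.+1) - f (grid t m k).

Lemma sum_incr t m f : \sum_(k < m.+1) incr t m f k = f t - f 0.
Proof.
rewrite -(big_mkord xpredT (incr t m f)) /incr.
by rewrite telescope_sumr// grid0 grid_last.
Qed.

Variables (M D V I : R -> R) (t B r : R).
Hypotheses (t0 : 0 <= t) (r0 : 0 < r) (B0 : 0 <= B).
Hypothesis MDI : forall u v, 0 <= u -> u <= v -> v <= t ->
  M v - M u = (D v - D u) - (I v - I u).
Hypothesis ILip : forall u v, 0 <= u -> u <= v -> v <= t -> `|I v - I u| <= B * (v - u).
Hypothesis DV : forall u v, 0 <= u -> u <= v -> v <= t -> v - u < r ->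
  [/\ (D v - D u) ^+ 2 = V v - V u, `|D v - D u| = V v - V u & `|D v - D u| <= 1].

Let step_cvg0 (c : R) : c / m.+1%:R @[m --> \oo] --> (0 : R).
Proof.
by rewrite -[X in _ --> X](mulr0 c); apply: cvgM; [exact: cvg_cst|exact: cvg_harmonic].
Qed.

(** With [h = B * t / m.+1%:R] bounding a step of [I], replacing an increment of [M] by that of [D]
    changes its square by at most [2 * h * |dD| + h ^+ 2]. Since [|dD|] is the increment of [V], the
    first term telescopes over the grid, and the total error is of the order of the mesh. *)
Lemma quadratic_variation_cvg :
  \sum_(k < m.+1) incr t m M k ^+ 2 @[m --> \oo] --> V t - V 0.
Proof.
pose X := V t - V 0.
apply: (@squeeze_cvgr _ _ _ _
  (* The numerator comes from [2 * h * X + m.+1%:R * h ^+ 2] with [h = B * t / m.+1%:R]. *)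
  (fun m => X - (2 * X * B * t + B * B * t * t) / m.+1%:R)
  (fun m => X + (2 * X * B * t + B * B * t * t) / m.+1%:R)); last 2 first.
- by rewrite -[X in _ --> X](subr0 X); apply: cvgB; [exact: cvg_cst|exact: step_cvg0].
- by rewrite -[X in _ --> X](addr0 X); apply: cvgD; [exact: cvg_cst|exact: step_cvg0].
near=> m.
have tr : t / m.+1%:R < r.
  by near: m; have /cvgr_lt/(_ _ r0) := step_cvg0 t; apply.
pose h := B * (t / m.+1%:R).
have h0 : 0 <= h by rewrite mulr_ge0// divr_ge0.
rewrite -ler_distlC.
have XE : X = \sum_(k < m.+1) incr t m D k ^+ 2.
  rewrite /X -(sum_incr t m V); apply: eq_bigr => k _.
  have [u0 uv vt] := grid_itv t0 (ltn_ord k : (k <= m)%N).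
  by have [] := DV u0 uv vt; rewrite ?grid_step.
rewrite [Y in `|Y - _|]XE -sumrB; apply: le_trans (ler_norm_sum _ _ _) _.
apply: (@le_trans _ _ (\sum_(k < m.+1) (2 * h * incr t m V k + h ^+ 2))).
  apply: ler_sum => k _.
  have [u0 uv vt] := grid_itv t0 (ltn_ord k : (k <= m)%N).
  have := MDI u0 uv vt; have := ILip u0 uv vt; rewrite grid_step -/h.
  have [] := DV u0 uv vt; first by rewrite grid_step.
  rewrite /incr => dV d1 _ ih ->.
  rewrite -d1.
  set dd := D _ - D _; set ii := I _ - I _ in ih *.
  have -> : dd ^+ 2 - (dd - ii) ^+ 2 = 2 * dd * ii - ii ^+ 2 by ring.
  apply: le_trans (ler_normB _ _) _; apply: lerD; last first.
    by rewrite normrX lerXn2r ?nnegrE.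
  rewrite -mulrA normrM normrM ger0_norm// -mulrA ler_wpM2l//.
  by rewrite mulrC ler_wpM2r.
rewrite big_split/= -mulr_sumr sum_incr -/X sumr_const card_ord -[_ *+ m.+1]mulr_natl.
rewrite le_eqVlt; apply/orP; left; apply/eqP; rewrite /h.
by field.
Unshelve. all: by end_near. Qed.

(* For a fine mesh the increments are at most 2, so that the clamp is inactive. *)
Lemma clamped_quadratic_variation_cvg (K : R) : 1 <= K ->
  \sum_(k < m.+1) `|incr t m M k| * Num.min `|incr t m M k| (4 * K) @[m --> \oo] --> V t - V 0.
Proof.
move=> K1; apply: cvg_trans quadratic_variation_cvg.
apply: near_eq_cvg; near=> m; apply: eq_bigr => k _.
have [u0 uv vt] := grid_itv t0 (ltn_ord k : (k <= m)%N).
have tr : t / m.+1%:R < r.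
  by near: m; have /cvgr_lt/(_ _ r0) := step_cvg0 t; apply.
have Bt : B * t / m.+1%:R < 1.
  by near: m; have /cvgr_lt/(_ _ ltr01) := step_cvg0 (B * t); apply.
have := MDI u0 uv vt; have := ILip u0 uv vt; rewrite grid_step mulrA.
have [] := DV u0 uv vt; first by rewrite grid_step.
rewrite /incr => _ _ d1 ih ->.
set dd := D _ - D _ in d1 *; set ii := I _ - I _ in ih *.
have dile : `|dd - ii| <= 4 * K.
  apply: le_trans (ler_normB _ _) _.
  apply: (@le_trans _ _ (1 + 1)); last lra.
  by apply: lerD => //; rewrite (le_trans ih)// ltW.
by rewrite min_l// -expr2 real_normK ?num_real.
Unshelve. all: by end_near. Qed.

(** The domination, uniform in [m], for passing to the limit in the clamped sums. Here [V] is any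
    path controlling the increments of [M]; it is applied to the jumps plus integrated intensities,
    not to the count that is the limit of the sums. *)
Lemma clamped_quadratic_variation_le (K : R) m : 0 <= K ->
  (forall u v, 0 <= u -> u <= v -> v <= t -> `|M v - M u| <= V v - V u) ->
  \sum_(k < m.+1) `|incr t m M k| * Num.min `|incr t m M k| (4 * K) <= 4 * K * (V t - V 0).
Proof.
move=> K0 MV; rewrite -(sum_incr t m V) mulr_sumr; apply: ler_sum => k _.
have [u0 uv vt] := grid_itv t0 (ltn_ord k : (k <= m)%N).
rewrite mulrC; apply: ler_pM => //; last exact: MV.
  by rewrite le_min normr_ge0/= mulr_ge0.
by rewrite ge_min lexx orbT.
Qed.

End grid.

(** * A truncation of the square with linear growth *)

Section truncated_square.
Context (R : realType).
Variable K : R.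
Hypothesis K0 : 0 <= K.
Notation c := (clamp K).

(** The variational inequality of the metric projection onto [[-K, K]], which is what [clamp K] is.
    The estimates on [truncated_sqr] from below and on its increments are squares plus this term. *)
Lemma clamp_projection (x z : R) : `|z| <= K -> 0 <= (x - c x) * (c x - z).
Proof.
rewrite ler_norml => /andP[z1 z2]; have [xK|Kx] := leP `|x| K.
  by rewrite clamp_id// subrr mul0r.
move: Kx; rewrite lter_normr => /orP[Kx|Kx].
  have -> : c x = K.
    by rewrite /clamp min_l ?(ltW Kx)// max_r// (le_trans _ K0)// oppr_le0.
  by rewrite mulr_ge0// subr_ge0// ltW.
have -> : c x = - K.
  rewrite /clamp max_l// ge_min; apply/orP; right; lra.
rewrite -mulrNN; apply: mulr_ge0; lra.
Qed.

(* This is [x ^+ 2 - (x - c x) ^+ 2]: quadratic on [-K, K], affine of slope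
   [2 * K] in absolute value outside. *)
Definition truncated_sqr (x : R) : R := 2 * x * c x - c x ^+ 2.

Lemma truncated_sqr_id (x : R) : `|x| <= K -> truncated_sqr x = x ^+ 2.
Proof. by move=> xK; rewrite /truncated_sqr clamp_id//; ring. Qed.

Lemma truncated_sqr_ge0 (x : R) : 0 <= truncated_sqr x.
Proof.
have -> : truncated_sqr x = c x ^+ 2 + 2 * ((x - c x) * (c x - 0)).
  by rewrite /truncated_sqr; ring.
by rewrite addr_ge0 ?sqr_ge0// mulr_ge0// clamp_projection// normr0.
Qed.

Lemma truncated_sqr_le (x : R) : truncated_sqr x <= 2 * K * `|x|.
Proof.
rewrite /truncated_sqr (@le_trans _ _ (2 * x * c x))//.
  by rewrite gerBl sqr_ge0.
rewrite (le_trans (ler_norm _))// !normrM ger0_norm// -mulrA -mulrA ler_wpM2l//.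
by rewrite mulrC ler_wpM2r// clamp_norm.
Qed.

(** A Taylor estimate in place of a change-of-variable formula: [truncated_sqr] is convex with
    derivative [2 * c x], and its remainder is at most the square of the step and at most [4 * K]
    times its length. The first factor of the linear term stays bounded, so that its product with a
    martingale increment is integrable. *)
Lemma truncated_sqr_increment (x y : R) :
  truncated_sqr y - truncated_sqr x - 2 * c x * (y - x) <=
  `|y - x| * Num.min `|y - x| (4 * K).
Proof.
have cK z : `|c z| <= K by exact: clamp_norm.
have p1 := clamp_projection x (cK y).
rewrite minr_pMr// le_min; apply/andP; split.
  rewrite -expr2 real_normK ?num_real// -subr_ge0.
  have -> : (y - x) ^+ 2 - (truncated_sqr y - truncated_sqr x - 2 * c x * (y - x)) =
    ((x - c x) - (y - c y)) ^+ 2 + 2 * ((x - c x) * (c x - c y)).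
    by rewrite /truncated_sqr; ring.
  by rewrite addr_ge0 ?sqr_ge0// mulr_ge0.
(* Convexity, with the slope at [y]. The remainder is then at most [2 * (y - x) * (c y - c x)], and
   the two clamped values differ by at most [2 * K]: this is the origin of [4 * K]. *)
have h : truncated_sqr y - truncated_sqr x <= 2 * (y - x) * c y.
  rewrite -subr_ge0.
  have -> : 2 * (y - x) * c y - (truncated_sqr y - truncated_sqr x) =
    (c x - c y) ^+ 2 + 2 * ((x - c x) * (c x - c y)).
    by rewrite /truncated_sqr; ring.
  by rewrite addr_ge0 ?sqr_ge0// mulr_ge0.
apply: (@le_trans _ _ (2 * ((y - x) * (c y - c x)))).
  rewrite (_ : 2 * ((y - x) * (c y - c x)) = 2 * (y - x) * c y - 2 * c x * (y - x)); last by ring.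
  by rewrite lerB.
rewrite (le_trans (ler_norm _))// !normrM ger0_norm// mulrCA ler_wpM2l//.
rewrite (le_trans (ler_wpM2l _ (ler_normB _ _)))//.
have := cK x; have := cK y; lra.
Qed.

Lemma truncated_sqr_measurable : measurable_fun setT truncated_sqr.
Proof.
have mc := @clamp_measurable R K.
apply: measurable_funB; last exact: measurable_funX.
by apply: measurable_funM => //; exact: measurable_funM.
Qed.

End truncated_square.

(** * Second moment of a martingale of integrable variation *)

Section martingales.
Context (R : realType) (d : measure_display) (T : measurableType d).
Variables (P : probability T R) (F : R -> set_system T).
Hypothesis hF : filtration F.

Lemma martingale_measurable M t : martingale P F M -> 0 <= t -> measurable_fun setT (M t).
Proof.
move=> [aM _ _] t0; apply: (measurable_wrt_measurable _ (aM t t0)).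
exact: (filtration_sub hF t0).
Qed.

Lemma martingaleD M M' (k : R) : martingale P F M -> martingale P F M' ->
  martingale P F (fun t w => M t w + k * M' t w).
Proof.
move=> [aM iM cM] [aM' iM' cM'].
have a t : 0 <= t -> measurable_wrt (F t) (fun w => M t w + k * M' t w).
  move=> t0; apply: measurable_wrtD; [exact: (filtration_sigma hF)|exact: aM|exact: aM'].
have i t : 0 <= t -> P.-integrable setT (EFin \o (fun w => M t w + k * M' t w)).
  by move=> t0; apply: RintegrableD => //; [exact: iM|apply: RintegrableZl => //; exact: iM'].
split=> // s t s0 st; have t0 := le_trans s0 st.
split=> [||A FA]; [exact: a|exact: i|].
have mA : measurable A by exact: (filtration_sub hF s0).
have iA X : P.-integrable setT (EFin \o X) -> P.-integrable A (EFin \o X).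
  by apply: integrableS => //; exact: subsetT.
have E r : 0 <= r -> (\int[P]_(w in A) (M r w + k * M' r w)%:E =
    \int[P]_(w in A) (M r w)%:E + k%:E * \int[P]_(w in A) (M' r w)%:E)%E.
  move=> r0; rewrite -(integralZl mA (iA _ (iM' r r0))).
  rewrite -(integralD mA (iA _ (iM r r0)))//.
  exact: (RintegrableZl mA k (iA _ (iM' r r0))).
have [_ _ eM] := cM s t s0 st; have [_ _ eM'] := cM' s t s0 st.
by rewrite E// E// eM// eM'.
Qed.

Variable M : R -> T -> R.
Hypothesis hM : martingale P F M.

(** Integrability is asked of the product only, so that the same statement serves bounded [Z] (a
    clamp, a sign) and the square-integrable [Z = M s]. *)
Lemma martingale_increment_orthogonal (Z : T -> R) s t : 0 <= s -> s <= t ->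
  measurable_wrt (F s) Z ->
  P.-integrable setT (EFin \o (fun w => Z w * (M t w - M s w))) ->
  \int[P]_w (Z w * (M t w - M s w)) = 0.
Proof.
move=> s0 st mZ iZ; have [aM iM cM] := hM.
have t0 := le_trans s0 st; have Fm := filtration_sub hF s0.
apply: (integral_mul_eq0 Fm _ _ mZ iZ).
  by apply: RintegrableB => //; exact: iM.
move=> A FA; have mA : measurable A by exact: Fm.
have iA r : 0 <= r -> P.-integrable A (EFin \o M r).
  by move=> r0; exact: (integrableS measurableT mA (@subsetT _ _) (iM r r0)).
rewrite (RintegralB mA (iA t t0) (iA s s0)) /Rintegral.
by have [_ _ ->//] := cM s t s0 st; rewrite subrr.
Qed.

Hypothesis M0 : forall w, M 0 w = 0.

Lemma martingale_mean0 t : 0 <= t -> \int[P]_w M t w = 0.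
Proof.
move=> t0; have [_ iM _] := hM.
have iMt := iM t t0.
have h : (fun w => 1 * (M t w - M 0 w)) = M t.
  by apply/funext => w; rewrite mul1r M0 subr0.
have := @martingale_increment_orthogonal (cst 1) 0 t (lexx _) t0.
rewrite /= h; apply => //.
move=> B mB; rewrite preimage_cst; case: ifPn => _.
  by have [h0 hD _] := filtration_sigma hF (lexx 0); rewrite -(setD0 setT); exact: hD.
by have [h0 _ _] := filtration_sigma hF (lexx 0).
Qed.

Section square.
Variables (t : R) (V : T -> R) (W : R -> T -> R).
Hypothesis t0 : 0 <= t.
Hypotheses (mV : measurable_fun setT V) (V0 : forall w, 0 <= V w).
Hypothesis iW : P.-integrable setT (EFin \o (fun w => W t w - W 0 w)).
Hypothesis MW : forall w u v, 0 <= u -> u <= v -> v <= t ->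
  `|M v w - M u w| <= W v w - W u w.
Hypothesis quadV : {ae P, forall w,
  \sum_(k < m.+1) incr t m (M^~ w) k ^+ 2 @[m --> \oo] --> V w}.
Hypothesis clampV : forall K, 1 <= K -> {ae P, forall w,
  \sum_(k < m.+1) `|incr t m (M^~ w) k| * Num.min `|incr t m (M^~ w) k| (4 * K)
  @[m --> \oo] --> V w}.

Let mM s : 0 <= s -> measurable_fun setT (M s). Proof. exact: martingale_measurable. Qed.

Let mincr m k : (k <= m)%N -> measurable_fun setT (fun w => incr t m (M^~ w) k).
Proof.
move=> km; have [u0 uv vt] := grid_itv t0 km.
by apply: measurable_funB; apply: mM => //; exact: le_trans uv.
Qed.

Let iincr m k : (k <= m)%N -> P.-integrable setT (EFin \o (fun w => incr t m (M^~ w) k)).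
Proof.
move=> km; have [u0 uv vt] := grid_itv t0 km; have [_ iM _] := hM.
by apply: RintegrableB => //; apply: iM => //; exact: le_trans uv.
Qed.

(** A discrete change of variables: [truncated_sqr K (M t w)] telescopes along the grid, the linear
    terms [f] have mean zero by orthogonality, and the remainders are at most [g], whose sums tend
    to [V] under the domination by [4 * K] times the increment of [W]. *)
Lemma truncated_sqr_mean_le K : 1 <= K -> \int[P]_w truncated_sqr K (M t w) <= \int[P]_w V w.
Proof.
move=> K1; have K0 : 0 <= K by exact: le_trans K1.
have [aM iM _] := hM.
pose g m k w := `|incr t m (M^~ w) k| * Num.min `|incr t m (M^~ w) k| (4 * K).
have mg m k : (k <= m)%N -> measurable_fun setT (g m k).
  move=> km; have := mincr km => h.
  apply: measurable_funM; first exact: measurableT_comp.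
  by apply: measurable_minr => //; exact: measurableT_comp.
have ig m k : (k <= m)%N -> P.-integrable setT (EFin \o g m k).
  move=> km; apply: (le_Rintegrable measurableT (g := fun w => 4 * K * `|incr t m (M^~ w) k|)).
  - exact: mg.
  - move=> w _; rewrite ger0_norm /g; last first.
      by rewrite mulr_ge0// le_min normr_ge0/= mulr_ge0.
    by rewrite mulrC ler_wpM2r// ge_min lexx orbT.
  - exact: (RintegrableZl measurableT _ (integrable_norm (iincr km))).
have mS m : measurable_fun setT (fun w => \sum_(k < m.+1) g m k w).
  by apply: measurable_sum => k; apply: mg; rewrite -ltnS.
have [||_ cvgS] := @Rdominated_cvg _ _ _ P (fun m w => \sum_(k < m.+1) g m k w) V
   (fun w => 4 * K * (W t w - W 0 w)) mS mV (clampV K1).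
- exact: (RintegrableZl measurableT _ iW).
- move=> m w; rewrite ger0_norm; last first.
    by apply: sumr_ge0 => k _; rewrite mulr_ge0// le_min normr_ge0/= mulr_ge0.
  exact: (clamped_quadratic_variation_le t0 m K0 (MW w)).
(* The left-hand side does not depend on the mesh, so a bound for every [m] passes to the limit. *)
suff h m : \int[P]_w truncated_sqr K (M t w) <= \int[P]_w (\sum_(k < m.+1) g m k w).
  rewrite -(cvg_lim (@Rhausdorff R) cvgS).
  by apply: limr_ge; [exact: cvgP cvgS|apply: nearW].
pose f k w := 2 * (clamp K (M (grid t m k) w) * incr t m (M^~ w) k).
have if_ k : (k < m.+1)%N -> P.-integrable setT (EFin \o f k).
  move=> km; have km' : (k <= m)%N by [].
  have [u0 uv vt] := grid_itv t0 km'.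
  apply: (RintegrableZl measurableT).
  apply: (le_Rintegrable measurableT (g := fun w => K * `|incr t m (M^~ w) k|)).
  - apply: measurable_funM; last exact: mincr.
    by apply: (measurableT_comp (@clamp_measurable R K)); exact: mM.
  - by move=> w _; rewrite normrM ler_wpM2r// clamp_norm.
  - exact: (RintegrableZl measurableT _ (integrable_norm (iincr km'))).
have f0 k : (k < m.+1)%N -> \int[P]_w f k w = 0.
  move=> km; have km' : (k <= m)%N by [].
  have [u0 uv vt] := grid_itv t0 km'.
  have i1 : P.-integrable setT (EFin \o (fun w => clamp K (M (grid t m k) w) * incr t m (M^~ w) k)).
    have := RintegrableZl measurableT 2^-1 (if_ k km).
    by apply: eq_integrable => // w _; rewrite /= /f mulrA mulVf// mul1r.
  rewrite (RintegralZl _ measurableT i1).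
  rewrite (@martingale_increment_orthogonal (clamp K \o M (grid t m k)))//; first by rewrite mulr0.
  by apply: measurable_wrt_comp; [exact: clamp_measurable|exact: aM].
have ig' k : (k < m.+1)%N -> P.-integrable setT (EFin \o g m k) by move=> km; exact: ig.
have iF := Rintegrable_sum measurableT if_.
have iG := Rintegrable_sum measurableT ig'.
apply: (@le_trans _ _ (\int[P]_w (\sum_(k < m.+1) f k w + \sum_(k < m.+1) g m k w))).
  apply: (le_Rintegral measurableT).
  - apply: (le_Rintegrable measurableT (g := fun w => 2 * K * `|M t w|)).
    + apply: (measurableT_comp (@truncated_sqr_measurable R K)); exact: mM.
    + by move=> w _; rewrite ger0_norm ?truncated_sqr_ge0// truncated_sqr_le.
    + exact: (RintegrableZl measurableT _ (integrable_norm (iM t t0))).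
  - exact: (RintegrableD measurableT iF iG).
  move=> w _; have -> : truncated_sqr K (M t w) =
      \sum_(k < m.+1) incr t m (fun s => truncated_sqr K (M s w)) k.
    by rewrite sum_incr M0 (truncated_sqr_id (x := 0)) ?normr0// expr0n subr0.
  rewrite -big_split/=; apply: ler_sum => k _; rewrite /f /g /incr -lerBlDl mulrA.
  exact: truncated_sqr_increment.
rewrite (RintegralD measurableT iF iG) (Rintegral_sum measurableT if_).
by rewrite big1 ?add0r// => k _; exact: f0.
Qed.

(** For each [w] the truncated square equals [M t w ^+ 2] as soon as the level exceeds [|M t w|],
    while its mean stays below that of [V]. Levels start at 1, as [truncated_sqr_mean_le]
    requires. *)
Lemma martingale_sqr_integrable :
  P.-integrable setT (EFin \o (fun w => M t w ^+ 2)) /\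
  \int[P]_w (M t w ^+ 2) <= \int[P]_w V w.
Proof.
have [aM iM _] := hM.
apply: (@Rfatou _ _ _ P (fun n w => truncated_sqr n.+1%:R (M t w))).
- move=> n; apply: (le_Rintegrable measurableT (g := fun w => 2 * n.+1%:R * `|M t w|)).
  + apply: (measurableT_comp (@truncated_sqr_measurable R _)); exact: mM.
  + by move=> w _; rewrite ger0_norm ?truncated_sqr_ge0// truncated_sqr_le.
  + exact: (RintegrableZl measurableT _ (integrable_norm (iM t t0))).
- by apply: measurable_funX; exact: mM.
- by move=> n w; exact: truncated_sqr_ge0.
- by move=> w; exact: sqr_ge0.
- apply: aeW => w; apply: cvg_near_cst; near=> n; rewrite truncated_sqr_id//.
  apply: (@le_trans _ _ n%:R); last by rewrite ler_nat.
  by near: n; exact: nbhs_infty_ger.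
- by move=> n; apply: truncated_sqr_mean_le; rewrite ler1n.
Unshelve. all: by end_near. Qed.

Hypothesis iM2 : forall s, 0 <= s <= t -> P.-integrable setT (EFin \o (fun w => M s w ^+ 2)).

Lemma martingale_sqr_mean_ge : \int[P]_w V w <= \int[P]_w (M t w ^+ 2).
Proof.
have [aM iM _] := hM.
have sq (x y : R) : `|x * y| <= x ^+ 2 + y ^+ 2.
  rewrite normrM -(real_normK (num_real x)) -(real_normK (num_real y)).
  have := sqr_ge0 (`|x| - `|y|); rewrite sqrrB => h.
  have : 0 <= `|x| * `|y| by rewrite mulr_ge0.
  lra.
have prod_int m k : (k <= m)%N ->
    P.-integrable setT (EFin \o (fun w => M (grid t m k) w * incr t m (M^~ w) k)).
  move=> km; have [u0 uv vt] := grid_itv t0 km.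
  have i1 := iM2 (_ : 0 <= grid t m k <= t); have i2 := iM2 (_ : 0 <= grid t m k.+1 <= t).
  have {}i1 := i1 ltac:(by rewrite u0 (le_trans uv)).
  have {}i2 := i2 ltac:(by rewrite vt (le_trans u0)).
  apply: (le_Rintegrable measurableT
    (g := fun w => 2 * M (grid t m k) w ^+ 2 + M (grid t m k.+1) w ^+ 2)).
  - by apply: measurable_funM; [exact: mM|exact: mincr].
  - move=> w _; rewrite /incr mulrBr (le_trans (ler_normB _ _))//.
    rewrite -expr2 (ger0_norm (sqr_ge0 _)).
    have := sq (M (grid t m k) w) (M (grid t m k.+1) w); lra.
  - exact: (RintegrableD measurableT (RintegrableZl measurableT 2 i1) i2).
pose f m k w := 2 * (M (grid t m k) w * incr t m (M^~ w) k).
have if_ m k : (k < m.+1)%N -> P.-integrable setT (EFin \o f m k).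
  by move=> km; apply: (RintegrableZl measurableT); exact: prod_int.
have f0 m k : (k < m.+1)%N -> \int[P]_w f m k w = 0.
  move=> km; have km' : (k <= m)%N by [].
  have [u0 uv vt] := grid_itv t0 km'.
  rewrite (RintegralZl _ measurableT (prod_int m k km')).
  rewrite (@martingale_increment_orthogonal (M (grid t m k)))//; first by rewrite mulr0.
  - exact: aM.
  - exact: prod_int.
have iMt : P.-integrable setT (EFin \o (fun w => M t w ^+ 2)).
  by apply: iM2; rewrite t0 lexx.
(* Summation by parts, using [M 0 = 0]. The terms [f] have mean zero, so the squared increments have
   the same mean for every mesh. *)
have E m w : \sum_(k < m.+1) incr t m (M^~ w) k ^+ 2 = M t w ^+ 2 - \sum_(k < m.+1) f m k w.
  have -> : M t w ^+ 2 = \sum_(k < m.+1) incr t m (fun s => M s w ^+ 2) k.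
    by rewrite sum_incr M0 expr0n subr0.
  rewrite -sumrB; apply: eq_bigr => k _; rewrite /f /incr; ring.
have iE m := RintegrableB measurableT iMt (Rintegrable_sum measurableT (if_ m)).
apply: (@Rfatou _ _ _ P (fun m w => \sum_(k < m.+1) incr t m (M^~ w) k ^+ 2)
  V (\int[P]_w (M t w ^+ 2)) _ mV _ V0 quadV _).2.
- by move=> m; apply: eq_integrable (iE m) => // w _ /=; rewrite E.
- by move=> m w; apply: sumr_ge0 => k _; exact: sqr_ge0.
- move=> m; under eq_Rintegral do rewrite E.
  rewrite (RintegralB measurableT iMt (Rintegrable_sum measurableT (if_ m))).
  rewrite (Rintegral_sum measurableT (if_ m)).
  by rewrite big1 ?subr0// => k _; exact: f0.
Qed.

End square.
End martingales.

(** * Moments of the Hawkes model *)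

Section exponential_integrals.
Context (R : realType).
Notation leb := (@lebesgue_measure R).

Lemma affine_expR_bound (a xi t s : R) : 0 <= s <= t ->
  `|a * expR (xi * (t - s))| <= `|a| * expR (`|xi| * t).
Proof.
move=> /andP[s0 st]; rewrite normrM ler_wpM2l// ger0_norm ?expR_ge0// ler_expR.
rewrite (le_trans (ler_norm _))// normrM ler_wpM2l// ger0_norm ?subr_ge0//.
by rewrite lerBlDr lerDl.
Qed.

Lemma affine_expR_measurable (a xi t : R) :
  measurable_fun setT (fun s : measurableTypeR R => a * expR (xi * (t - s))).
Proof.
apply: measurable_funM => //.
apply: (eq_measurable_fun (fun s : measurableTypeR R => expR (xi * t) * expR (- xi * s))).
  by move=> s _; rewrite -expRD; congr expR; ring.
by apply: measurable_funM => //; exact: measurable_expRM.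
Qed.

(** [H] is a primitive, found by parts from [e' = - xi * e]. The integrand is general enough for all
    the time integrals met in the covariance and in the second moment below. *)
Lemma Rintegral_affine_exp (xi t p q r x y : R) : xi != 0 -> x <= y ->
  let e s := expR (xi * (t - s)) in
  let H s := - (e s * (p * s + q + p / xi)) / xi - r / (2 * xi) * e s ^+ 2 in
  \int[leb]_(s in `[x, y]) ((p * s + q) * e s + r * e s ^+ 2) = H y - H x.
Proof.
move=> xi0 xy e H.
have de (s : R) : is_derive s 1 e (- xi * e s).
  apply: is_derive_eq; rewrite /GRing.scale/= /e; ring.
have ce : continuous e.
  move=> s; have [ds _] := de s.
  exact: (differentiable_continuous ((derivable1_diffP _ _).1 ds)).
apply: Rintegral_FTC2 => //.
  move=> s; apply: cvgD.
    apply: cvgM; last exact: ce.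
    apply: cvgD; last exact: cvg_cst.
    by apply: cvgM; [exact: cvg_cst|exact: cvg_id].
  by apply: cvgM; [exact: cvg_cst|apply: cvgM; exact: ce].
move=> s; have := de s => ds.
apply: is_derive_eq; rewrite /GRing.scale/= /e; by field.
Qed.

(** Cauchy-Schwarz against the constant 1: the integral of [(f - c) ^+ 2] is nonnegative when [c] is
    the average of [f]. *)
Lemma Rintegral_sqr_le (f : R -> R) (t : R) : 0 <= t ->
  leb.-integrable `[0, t] (EFin \o f) ->
  leb.-integrable `[0, t] (EFin \o (fun s => f s ^+ 2)) ->
  (\int[leb]_(s in `[0, t]) f s) ^+ 2 <= t * \int[leb]_(s in `[0, t]) (f s ^+ 2).
Proof.
rewrite le_eqVlt => /predU1P[<-|t0] i1 i2.
  by rewrite set_itv1 Rintegral_set1 expr0n mul0r.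
have mt := measurableR_itv `[0, t].
set J := \int[leb]_(s in `[0, t]) f s.
pose c := J / t.
have i3 := RintegrableZl mt (2 * c) i1.
have i4 := Rintegrable_cst_itv (c ^+ 2) 0 t.
have : 0 <= \int[leb]_(s in `[0, t]) (f s ^+ 2 - 2 * c * f s + c ^+ 2).
  apply: Rintegral_ge0 => s _.
  by rewrite (_ : _ + _ = (f s - c) ^+ 2) ?sqr_ge0//; ring.
rewrite (RintegralD mt (RintegrableB mt i2 i3) i4) (RintegralB mt i2 i3).
rewrite (RintegralZl _ mt i1) (Rintegral_cst _ mt) -/J.
have -> : fine (leb `[0, t]%classic) = t by rewrite fine_lebesgue_itvcc ?subr0// ltW.
set S := \int[leb]_(s in `[0, t]) (f s ^+ 2).
have -> : S - 2 * c * J + c ^+ 2 * t = S - J ^+ 2 / t.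
  by rewrite /c; field; rewrite gt_eqF.
by rewrite subr_ge0 ler_pdivrMr// mulrC.
Qed.

End exponential_integrals.

Section L1.
Context (R : realType) (d : measure_display) (T : measurableType d).
Variables (P : probability T R) (F : R -> set_system T).
Hypothesis hF : filtration F.

(* Test the martingale property against the sign of [M s]. *)
Lemma martingale_L1_mono M s t : martingale P F M -> 0 <= s -> s <= t ->
  \int[P]_w `|M s w| <= \int[P]_w `|M t w|.
Proof.
move=> hM s0 st; have [aM iM _] := hM; have t0 := le_trans s0 st.
pose h (x : R) : R := if 0 <= x then 1 else -1.
have mh : measurable_fun setT h.
  apply: measurable_fun_ifT => //; exact: measurable_fun_ler.
have h1 x : `|h x| = 1 by rewrite /h; case: ifP => _; rewrite ?normrN normr1.
have hx x : h x * x = `|x|.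
  rewrite /h; case: ifPn => x0; first by rewrite mul1r ger0_norm.
  by rewrite mulN1r ler0_norm// ltW// ltNge.
have iZ u : 0 <= u -> P.-integrable setT (EFin \o (fun w => h (M s w) * M u w)).
  move=> u0; apply: (le_Rintegrable measurableT (g := fun w => `|M u w|)).
  - apply: measurable_funM; last exact: (martingale_measurable hF hM).
    by apply: (measurableT_comp mh); exact: (martingale_measurable hF hM).
  - by move=> w _; rewrite normrM h1 mul1r.
  - exact: (integrable_norm (iM u u0)).
have iB : P.-integrable setT (EFin \o (fun w => h (M s w) * (M t w - M s w))).
  have := RintegrableB measurableT (iZ t t0) (iZ s s0).
  by apply: eq_integrable => // w _ /=; rewrite mulrBr.
have := @martingale_increment_orthogonal _ _ _ P F hF M hM (h \o M s) s t s0 st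
  (measurable_wrt_comp mh (aM s s0)) iB.
under eq_Rintegral do rewrite /= mulrBr hx.
rewrite (RintegralB measurableT (iZ t t0) (integrable_norm (iM s s0))) => /eqP.
rewrite subr_eq0 => /eqP <-.
apply: (le_Rintegral measurableT (iZ t t0) (integrable_norm (iM t t0))) => w _.
by rewrite (le_trans (ler_norm _))// normrM h1 mul1r.
Qed.

End L1.

Section hawkes_moments.
Context (R : realType) (d : measure_display) (T : measurableType d).
Notation leb := (@lebesgue_measure R).
Variables (P : probability T R) (F : R -> set_system T).
Variables (N1 N2 : simple_counting_process R T) (lambda1 lambda2 : R -> T -> R).
Variables (mu alpha_s alpha_c beta l0 : R).
Hypothesis hmodel : symmetric_hawkes P F mu alpha_s alpha_c beta N1 N2 lambda1 lambda2.
Hypotheses (beta0 : 0 < beta) (mu0 : 0 <= mu) (mul0 : mu <= l0).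
Hypotheses (as0 : 0 <= alpha_s) (ac0 : 0 <= alpha_c).
Hypotheses (l10 : forall w, lambda1 0 w = l0) (l20 : forall w, lambda2 0 w = l0).

Let hF := hawkes_filtration hmodel.
Let eq1 := hawkes_equation1 hmodel.
Let eq2 := hawkes_equation2 hmodel.
Let cad1 := hawkes_cadlag1 hmodel.
Let cad2 := hawkes_cadlag2 hmodel.

Let mul1 w : mu <= lambda1 0 w. Proof. by rewrite l10. Qed.
Let mul2 w : mu <= lambda2 0 w. Proof. by rewrite l20. Qed.

Let I1 w s := \int[leb]_(v in `[0, s]) lambda1 v w.
Let I2 w s := \int[leb]_(v in `[0, s]) lambda2 v w.
Let C1 := compensated N1 lambda1.
Let C2 := compensated N2 lambda2.
Let B1 w t := intensity_bound N1 N2 lambda1 alpha_s alpha_c w t.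
Let B2 w t := intensity_bound N1 N2 lambda2 alpha_c alpha_s w t.

Let dI1 w s u t : 0 <= s -> s <= u -> u <= t ->
  0 <= I1 w u - I1 w s <= B1 w t * (u - s).
Proof.
by move=> s0 su ut; exact: (integrated_intensity_increment beta0 eq1 mu0 (mul1 w) as0 ac0 s0 su ut).
Qed.

Let dI2 w s u t : 0 <= s -> s <= u -> u <= t ->
  0 <= I2 w u - I2 w s <= B2 w t * (u - s).
Proof.
by move=> s0 su ut; exact: (integrated_intensity_increment beta0 eq2 mu0 (mul2 w) ac0 as0 s0 su ut).
Qed.

Let B10 w t : 0 <= t -> 0 <= B1 w t.
Proof.
move=> t0.
by have /andP[/le_trans h /h] := intensity_bounds beta0 eq1 mu0 (mul1 w) as0 ac0 (lexx 0) t0.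
Qed.

Let B20 w t : 0 <= t -> 0 <= B2 w t.
Proof.
move=> t0.
by have /andP[/le_trans h /h] := intensity_bounds beta0 eq2 mu0 (mul2 w) ac0 as0 (lexx 0) t0.
Qed.

Definition signed_compensated (sg : R) (s : R) (w : T) : R := C1 s w + sg * C2 s w.
Notation M := signed_compensated.

Definition total_count (t : R) (w : T) : R :=
  ((N1 t w)%:R - (N1 0 w)%:R) + ((N2 t w)%:R - (N2 0 w)%:R).

(** A majorant of the variation of both signed martingales, jumps plus drift. *)
Let W (s : R) (w : T) : R := (N1 s w)%:R + (N2 s w)%:R + (I1 w s + I2 w s).

Lemma signed_compensated_martingale sg : martingale P F (M sg).
Proof. exact: (martingaleD hF _ (hawkes_intensity1 hmodel) (hawkes_intensity2 hmodel)). Qed.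

Let Mmart := signed_compensated_martingale.

Lemma signed_compensated_measurable sg s : 0 <= s -> measurable_fun setT (M sg s).
Proof. exact: (martingale_measurable hF (Mmart sg)). Qed.

Lemma signed_compensated0 sg w : M sg 0 w = 0.
Proof.
have I0 (l : R -> T -> R) : \int[leb]_(v in `[0, 0]) l v w = 0.
  by rewrite set_itv1 Rintegral_set1.
by rewrite /M /C1 /C2 /compensated !I0 !subrr mulr0 addr0.
Qed.

Lemma signed_compensated_right_continuous sg w s : 0 <= s ->
  M sg u w @[u --> s^'+] --> M sg s w.
Proof.
move=> s0; apply: cvgD.
  exact: (compensated1_right_continuous beta0 mu0 mul0 as0 ac0 eq1 l10).
apply: cvgM; first exact: cvg_cst.
exact: (compensated2_right_continuous beta0 mu0 mul0 as0 ac0 eq2 l20).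
Qed.

Lemma signed_compensated_variation sg w u v : `|sg| = 1 -> 0 <= u -> u <= v ->
  `|M sg v w - M sg u w| <= W v w - W u w.
Proof.
move=> sg1 u0 uv.
have /andP[h1 _] := dI1 w u0 uv (lexx v).
have /andP[h2 _] := dI2 w u0 uv (lexx v).
have n1 : (N1 u w)%:R <= (N1 v w)%:R :> R by rewrite ler_nat count_nondecreasing.
have n2 : (N2 u w)%:R <= (N2 v w)%:R :> R by rewrite ler_nat count_nondecreasing.
have -> : M sg v w - M sg u w = (((N1 v w)%:R - (N1 u w)%:R) - (I1 w v - I1 w u)) +
   sg * (((N2 v w)%:R - (N2 u w)%:R) - (I2 w v - I2 w u)).
  by rewrite /M /C1 /C2 /compensated -/(I1 w v) -/(I1 w u) -/(I2 w v) -/(I2 w u); ring.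
rewrite (le_trans (ler_normD _ _))// normrM sg1 mul1r.
have nB (x y : R) : 0 <= x -> 0 <= y -> `|x - y| <= x + y.
  by move=> x0 y0; rewrite (le_trans (ler_normB _ _))// !ger0_norm.
have k1 := nB _ _ (_ : 0 <= (N1 v w)%:R - (N1 u w)%:R) h1.
have k2 := nB _ _ (_ : 0 <= (N2 v w)%:R - (N2 u w)%:R) h2.
rewrite !subr_ge0 in k1 k2; apply: le_trans (lerD (k1 n1) (k2 n2)) _.
by rewrite /W le_eqVlt; apply/orP; left; apply/eqP; ring.
Qed.

Lemma signed_compensated_bounded sg w s t : `|sg| = 1 -> 0 <= s <= t ->
  `|M sg s w| <= W t w - W 0 w.
Proof.
move=> sg1 /andP[s0 st].
have := signed_compensated_variation w sg1 (lexx 0) s0.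
have := signed_compensated_variation w sg1 s0 st.
rewrite signed_compensated0 subr0 => h1 h2.
have := normr_ge0 (M sg t w - M sg s w); lra.
Qed.

Lemma signed_compensated_path_integrable sg w t : `|sg| = 1 ->
  leb.-integrable `[0, t] (EFin \o (M sg ^~ w)).
Proof.
move=> sg1; apply: right_continuous_bounded_integrable.
  by move=> s s0; exact: signed_compensated_right_continuous.
by move=> s st; exact: signed_compensated_bounded st.
Qed.

(** In the representation with [sg = 1] the count is a deterministic drift plus terms linear in a
    centred martingale. Integrability, not only the value of the mean, comes from there. *)
Lemma total_count_mean t : 0 <= t ->
  let xi := alpha_s + alpha_c - beta in
  xi != 0 -> beta * mu + xi * l0 = 0 ->
  P.-integrable setT (EFin \o total_count t) /\
  \int[P]_w total_count t w = 2 * l0 * t.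
Proof.
move=> t0 xi xi0 stat.
pose a := alpha_s + alpha_c.
pose J w := \int[leb]_(s in `[0, t]) (a * expR (xi * (t - s)) * M 1 s w).
have E w : total_count t w = M 1 t w + 2 * l0 * t + J w.
  have := @signed_count_representation R d T N1 N2 lambda1 lambda2 mu alpha_s alpha_c beta l0
    beta0 mu0 mul0 as0 ac0 eq1 eq2 cad1 cad2 l10 l20 1 t w (expr1n _ _) t0.
  cbv zeta; have -> : alpha_s + 1 * alpha_c = a by rewrite mul1r.
  rewrite -/xi stat mulr0 => /(_ xi0 erefl); rewrite [1 * (_ - _)]mul1r /total_count => ->.
  by rewrite /J.
have [_ iM _] := Mmart 1.
(* The uniform bound on first absolute moments over [[0, t]] is their value at [t], as they increase
   in time. *)
have [iJ EJ] := @expectation_integral d T R P (M 1) (fun s => a * expR (xi * (t - s))) t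
  (\int[P]_w `|M 1 t w|) _
  (@signed_compensated_measurable 1)
  (@signed_compensated_right_continuous 1)
  (fun s (st : 0 <= s <= t) => iM s (proj1 (andP st)))
  (fun s st => martingale_L1_mono hF (Mmart 1) (proj1 (andP st)) (proj2 (andP st)))
  (fun w => signed_compensated_path_integrable w t (normr1 _))
  (affine_expR_measurable _ _ _) (@affine_expR_bound R a xi t).
have ic : P.-integrable setT (EFin \o (fun=> 2 * l0 * t)).
  exact: finite_measure_integrable_cst.
have i1 := RintegrableD measurableT (iM t t0) ic.
have i2 := RintegrableD measurableT i1 iJ.
split; first by apply: eq_integrable i2 => // w _ /=; rewrite E.
under eq_Rintegral do rewrite E.
rewrite (RintegralD measurableT i1 iJ) (RintegralD measurableT (iM t t0) ic) EJ.
rewrite (Rintegral_cst _ measurableT).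
have -> : fine (P setT) = 1 by rewrite probability_setT.
have m0 s : 0 <= s -> \int[P]_w M 1 s w = 0.
  exact: (martingale_mean0 hF (Mmart 1) (signed_compensated0 1)).
rewrite m0// add0r mulr1 (@eq_Rintegral _ _ _ leb _ (cst 0)); last first.
  by move=> s; rewrite inE/= in_itv/= => /andP[s0 _]; rewrite m0// mulr0.
by rewrite Rintegral_cst ?mul0r ?addr0//; exact: measurableR_itv.
Qed.

Lemma signed_compensated_sqr t : 0 <= t ->
  (forall s, 0 <= s -> P.-integrable setT (EFin \o total_count s)) ->
  P.-integrable setT (EFin \o (fun w => M (-1) t w ^+ 2)) /\
  \int[P]_w (M (-1) t w ^+ 2) = \int[P]_w total_count t w.
Proof.
move=> t0 iV; have [_ iMp _] := Mmart 1.
have sg1 : `|(-1) : R| = 1 by rewrite normrN normr1.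
have V0 s w : 0 <= s -> 0 <= total_count s w.
  by move=> s0; rewrite addr_ge0// subr_ge0 ler_nat count_nondecreasing.
have mV s : 0 <= s -> measurable_fun setT (total_count s).
  by move=> s0; have /measurable_int/measurable_EFinP := iV s s0.
have iW s : 0 <= s -> P.-integrable setT (EFin \o (fun w => W s w - W 0 w)).
  move=> s0.
  (* [W s - W 0] equals [2 * total_count s - M 1 s], a difference of integrable variables. *)
  have := RintegrableB measurableT (RintegrableZl measurableT 2 (iV s s0)) (iMp s s0).
  apply: eq_integrable => // w _; congr EFin.
  have := signed_compensated0 1 w.
  rewrite /W /total_count /M /C1 /C2 /compensated -/(I1 w s) -/(I2 w s) -/(I1 w 0) -/(I2 w 0).
  lra.
have quad s w : 0 <= s -> (forall u, 0 < u -> jump N1 w u = 0 \/ jump N2 w u = 0) ->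
  \sum_(k < m.+1) incr s m ((M (-1))^~ w) k ^+ 2 @[m --> \oo] --> total_count s w /\
  (forall K, 1 <= K -> 
  \sum_(k < m.+1) `|incr s m ((M (-1))^~ w) k| * Num.min `|incr s m ((M (-1))^~ w) k| (4 * K)
  @[m --> \oo] --> total_count s w).
  move=> s0 noc; have [r r0 hr] := isolated_jumps s noc.
  pose D u : R := (N1 u w)%:R - (N2 u w)%:R.
  pose V u : R := (N1 u w)%:R + (N2 u w)%:R.
  pose J u : R := I1 w u - I2 w u.
  have VE : V s - V 0 = total_count s w by rewrite /V /total_count; ring.
  have B0 : 0 <= B1 w s + B2 w s by rewrite addr_ge0 ?B10 ?B20.
  have MDI u v : 0 <= u -> u <= v -> v <= s ->
      M (-1) v w - M (-1) u w = (D v - D u) - (J v - J u).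
    move=> _ _ _; rewrite /M /C1 /C2 /compensated -/(I1 w v) -/(I1 w u) -/(I2 w v) -/(I2 w u).
    by rewrite /D /J; ring.
  have JLip u v : 0 <= u -> u <= v -> v <= s -> `|J v - J u| <= (B1 w s + B2 w s) * (v - u).
    move=> u0 uv vs; have /andP[p1 q1] := dI1 w u0 uv vs; have /andP[p2 q2] := dI2 w u0 uv vs.
    rewrite (_ : J v - J u = (I1 w v - I1 w u) - (I2 w v - I2 w u)); last by rewrite /J; ring.
    by rewrite (le_trans (ler_normB _ _))// !ger0_norm// mulrDl lerD.
  have DV u v : 0 <= u -> u <= v -> v <= s -> v - u < r ->
      [/\ (D v - D u) ^+ 2 = V v - V u, `|D v - D u| = V v - V u & `|D v - D u| <= 1].
    move=> u0 uv vs uvr; have := hr u v u0 uv vs uvr.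
    have n1 : (N1 u w <= N1 v w)%N by exact: count_nondecreasing.
    have n2 : (N2 u w <= N2 v w)%N by exact: count_nondecreasing.
    rewrite /D /V -(subnKC n1) -(subnKC n2) !natrD.
    move: (N1 v w - N1 u w)%N (N2 v w - N2 u w)%N => p q.
    rewrite addnACA leq_add2l.
    rewrite (_ : _ - _ - (_ - _) = p%:R - q%:R); last by ring.
    rewrite (_ : _ + _ - (_ + _) = p%:R + q%:R); last by ring.
    (* Since [p + q <= 1], only (0,0), (0,1) and (1,0) survive, and in each of them
       [(p - q) ^+ 2 = |p - q| = p + q]. *)
    case: p => [|[|p]]; case: q => [|[|q]] //= _.
    - by rewrite subr0 addr0 expr0n normr0.
    - by rewrite sub0r add0r sqrrN expr1n normrN normr1.
    - by rewrite subr0 addr0 expr1n normr1.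
  by rewrite -VE; split;
    [exact: (quadratic_variation_cvg s0 r0 B0 MDI JLip DV)
    |move=> K; exact: (clamped_quadratic_variation_cvg s0 r0 B0 MDI JLip DV)].
have ncj := hawkes_no_common_jumps hmodel.
have MW s w u v : 0 <= u -> u <= v -> v <= s ->
    `|M (-1) v w - M (-1) u w| <= W v w - W u w.
  by move=> u0 uv _; exact: signed_compensated_variation.
have up s : 0 <= s -> P.-integrable setT (EFin \o (fun w => M (-1) s w ^+ 2)) /\
    \int[P]_w (M (-1) s w ^+ 2) <= \int[P]_w total_count s w.
  move=> s0.
  apply: (martingale_sqr_integrable hF (Mmart (-1)) (signed_compensated0 _) s0
    (mV s s0) (W := W)) => //.
  - exact: iW.
  - exact: MW.
  - move=> K K1; apply: filterS ncj => w noc.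
    by have [_] := quad s w s0 noc; apply.
split; first exact: (up t t0).1.
apply/eqP; rewrite eq_le (up t t0).2/=.
apply: (martingale_sqr_mean_ge hF (Mmart (-1)) (signed_compensated0 _) t0 (mV t t0)) => //.
- by move=> w; exact: V0.
- by apply: filterS ncj => w noc; have [] := quad t w t0 noc.
- by move=> s /andP[s0 _]; exact: (up s s0).1.
Qed.

End hawkes_moments.

(** * Second moment of a Volterra transform of a martingale *)

Section volterra_second_moment.
Context (R : realType) (d : measure_display) (T : measurableType d).
Notation leb := (@lebesgue_measure R).
Variables (P : probability T R) (F : R -> set_system T).
Hypothesis hF : filtration F.
Variables (M : R -> T -> R) (a xi v : R).
Hypothesis hM : martingale P F M.
Hypothesis M0 : forall w, M 0 w = 0.
Hypothesis rM : forall w (s : R), 0 <= s -> M u w @[u --> s^'+] --> M s w.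
Hypothesis bM : forall w (t : R), exists K : R, forall s : R, 0 <= s <= t -> `|M s w| <= K.
Hypothesis iM2 : forall s : R, 0 <= s -> P.-integrable setT (EFin \o (fun w => M s w ^+ 2)).
Hypothesis EM2 : forall s : R, 0 <= s -> \int[P]_w (M s w ^+ 2) = v * s.
Hypotheses (v0 : 0 <= v) (xi0 : xi != 0).

Let mM s : 0 <= s -> measurable_fun setT (M s). Proof. exact: (martingale_measurable hF hM). Qed.

Let norm_mul_le (x y : R) : `|x * y| <= x ^+ 2 + y ^+ 2.
Proof.
rewrite normrM -(real_normK (num_real x)) -(real_normK (num_real y)).
have := sqr_ge0 (`|x| - `|y|); rewrite sqrrB => h.
have : 0 <= `|x| * `|y| by rewrite mulr_ge0.
lra.
Qed.

Let sqr_sub_le (x y : R) : (x + y) ^+ 2 <= 2 * x ^+ 2 + 2 * y ^+ 2.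
Proof.
rewrite -subr_ge0 (_ : _ - _ = (x - y) ^+ 2); last by ring.
exact: sqr_ge0.
Qed.

Let iMul (Y Z : T -> R) : measurable_fun setT Y -> measurable_fun setT Z ->
  P.-integrable setT (EFin \o (fun w => Y w ^+ 2)) ->
  P.-integrable setT (EFin \o (fun w => Z w ^+ 2)) ->
  P.-integrable setT (EFin \o (fun w => Y w * Z w)).
Proof.
move=> mY mZ iY iZ.
apply: (le_Rintegrable measurableT (g := fun w => Y w ^+ 2 + Z w ^+ 2)).
- exact: measurable_funM.
- by move=> w _; exact: norm_mul_le.
- exact: (RintegrableD measurableT iY iZ).
Qed.

Lemma martingale_covariance s u : 0 <= s -> s <= u -> \int[P]_w (M s w * M u w) = v * s.
Proof.
move=> s0 su; have u0 := le_trans s0 su; have [aM iM _] := hM.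
have i1 := iMul (mM s0) (mM u0) (iM2 s0) (iM2 u0).
have iB : P.-integrable setT (EFin \o (fun w => M s w * (M u w - M s w))).
  have := RintegrableB measurableT i1 (iM2 s0).
  by apply: eq_integrable => // w _ /=; rewrite mulrBr expr2.
have := martingale_increment_orthogonal hF hM s0 su (aM s s0) iB.
have -> : \int[P]_w (M s w * (M u w - M s w)) = \int[P]_w (M s w * M u w - M s w ^+ 2).
  by apply: eq_Rintegral => w _; rewrite mulrBr expr2.
rewrite (RintegralB measurableT i1 (iM2 s0)) EM2// => /eqP.
by rewrite subr_eq0 => /eqP.
Qed.

Variable t : R.
Hypothesis t0 : 0 <= t.

Let phi s := a * expR (xi * (t - s)).
Let J w := \int[leb]_(s in `[0, t]) (phi s * M s w).
Let D w := M t w + J w.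

Let pM w : leb.-integrable `[0, t] (EFin \o (M ^~ w)).
Proof.
have [K hK] := bM w t.
exact: (right_continuous_bounded_integrable (@rM w) hK).
Qed.

Let mphi : measurable_fun setT (phi : measurableTypeR R -> R).
Proof. exact: affine_expR_measurable. Qed.

Let bphi s : 0 <= s <= t -> `|phi s| <= `|a| * expR (`|xi| * t).
Proof. exact: affine_expR_bound. Qed.

Let pphiM w : leb.-integrable `[0, t] (EFin \o (fun s => phi s * M s w)).
Proof.
apply: (le_Rintegrable (measurableR_itv _) (g := fun s => `|a| * expR (`|xi| * t) * `|M s w|)).
- apply: measurable_funM; first exact: measurable_funTS mphi.
  by have /measurable_int/measurable_EFinP := pM w.
- move=> s; rewrite /= in_itv => st; rewrite normrM; exact: (ler_wpM2r (normr_ge0 _) (bphi st)).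
- exact: (RintegrableZl (measurableR_itv _) _ (integrable_norm (pM w))).
Qed.

Let EM2_le s : 0 <= s <= t -> \int[P]_w (M s w ^+ 2) <= v * t.
Proof. by move=> /andP[s0 st]; rewrite EM2// ler_wpM2l. Qed.

(** Cauchy-Schwarz in time bounds [J ^+ 2] by [t] times the integral of [(phi * M) ^+ 2], which is
    integrable in [w] by Fubini since [E[M(s)^2] <= v * t] on [[0, t]]. *)
Lemma volterra_sqr_integrable :
  measurable_fun setT D /\ P.-integrable setT (EFin \o (fun w => D w ^+ 2)).
Proof.
have [_ iM _] := hM.
have [iJ _] : P.-integrable setT (EFin \o J) /\
    \int[P]_w J w = \int[leb]_(s in `[0, t]) (phi s * \int[P]_w M s w).
  apply: (expectation_integral (@mM) (@rM) (C := \int[P]_w `|M t w|) _ _ pM mphi (@bphi)).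
  - by move=> s /andP[s0 _]; exact: iM.
  - by move=> s /andP[s0 st]; exact: (@martingale_L1_mono _ _ _ _ _ hF _ _ _ hM s0 st).
have mJ : measurable_fun setT J by have /measurable_int/measurable_EFinP := iJ.
have mD : measurable_fun setT D by apply: measurable_funD => //; exact: mM.
split=> //.
have pM2 w : leb.-integrable `[0, t] (EFin \o (fun s => M s w ^+ 2)).
  have [K hK] := bM w t.
  apply: (right_continuous_bounded_integrable (K := K ^+ 2)).
    by move=> s s0; apply: cvgM; exact: rM.
  move=> s st; rewrite normrX lerXn2r ?nnegrE//; last exact: hK.
  exact: le_trans (normr_ge0 _) (hK s st).
have pf2 w : leb.-integrable `[0, t] (EFin \o (fun s => phi s ^+ 2 * M s w ^+ 2)).
  apply: (le_Rintegrable (measurableR_itv _)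
    (g := fun s => (`|a| * expR (`|xi| * t)) ^+ 2 * M s w ^+ 2)).
  - apply: measurable_funM; first by apply: measurable_funX; exact: measurable_funTS mphi.
    by have /measurable_int/measurable_EFinP := pM2 w.
  - move=> s; rewrite /= in_itv => st; rewrite (ger0_norm (mulr_ge0 (sqr_ge0 _) (sqr_ge0 _))).
    apply: ler_wpM2r; first exact: sqr_ge0.
    rewrite -(real_normK (num_real (phi s))) lerXn2r ?nnegrE ?mulr_ge0 ?expR_ge0//; exact: bphi.
  - exact: (RintegrableZl (measurableR_itv _) _ (pM2 w)).
have [iJ2 _] : P.-integrable setT (EFin \o (fun w =>
     \int[leb]_(s in `[0, t]) (phi s ^+ 2 * M s w ^+ 2))) /\ 
    \int[P]_w (\int[leb]_(s in `[0, t]) (phi s ^+ 2 * M s w ^+ 2)) =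
    \int[leb]_(s in `[0, t]) (phi s ^+ 2 * \int[P]_w (M s w ^+ 2)).
  apply: (expectation_integral (X := fun s w => M s w ^+ 2) (phi := fun s => phi s ^+ 2)
    (C := v * t) (K := (`|a| * expR (`|xi| * t)) ^+ 2)).
  - by move=> s s0; apply: measurable_funX; exact: mM.
  - by move=> w s s0; apply: cvgM; exact: rM.
  - by move=> s /andP[s0 _]; exact: iM2.
  - move=> s st; under eq_Rintegral do rewrite (ger0_norm (sqr_ge0 _)).
    exact: EM2_le.
  - exact: pM2.
  - exact: measurable_funX.
  - move=> s st; rewrite normrX lerXn2r ?nnegrE ?mulr_ge0 ?expR_ge0//; exact: bphi.
apply: (le_Rintegrable measurableT (g := fun w => 2 * M t w ^+ 2 +
   2 * (t * \int[leb]_(s in `[0, t]) (phi s ^+ 2 * M s w ^+ 2)))).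
- exact: measurable_funX.
- move=> w _; rewrite (ger0_norm (sqr_ge0 _)); apply: le_trans (sqr_sub_le _ _) _.
  rewrite lerD2l ler_wpM2l//.
  have pf2' : leb.-integrable `[0, t] (EFin \o (fun s => (phi s * M s w) ^+ 2)).
    apply: (eq_integrable (measurableR_itv _)) (pf2 w) => s _.
    by congr EFin; rewrite [RHS]exprMn.
  apply: le_trans (Rintegral_sqr_le t0 (pphiM w) pf2') _.
  under eq_Rintegral do rewrite exprMn.
  exact: lexx.
- apply: (RintegrableD measurableT); first exact: (RintegrableZl measurableT _ (iM2 t0)).
  by do 2 apply: (RintegrableZl measurableT).
Qed.

(** Pairing with a free [Z] moves the expectation inside the time integral. Taking [Z] to be 1,
    [M s] and finally [D] itself reduces the mean and the second moment of [D] to the covariance of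
    [M]. *)
Lemma volterra_covariance (Z : T -> R) : measurable_fun setT Z ->
  P.-integrable setT (EFin \o (fun w => Z w ^+ 2)) ->
  \int[P]_w (Z w * D w) = \int[P]_w (Z w * M t w) +
    \int[leb]_(s in `[0, t]) (phi s * \int[P]_w (Z w * M s w)).
Proof.
move=> mZ iZ2.
have iZM s : 0 <= s -> P.-integrable setT (EFin \o (fun w => Z w * M s w)).
  by move=> s0; exact: iMul mZ (mM s0) iZ2 (iM2 s0).
have [i1 e1] : P.-integrable setT (EFin \o (fun w =>
     \int[leb]_(s in `[0, t]) (phi s * (Z w * M s w)))) /\ 
    \int[P]_w (\int[leb]_(s in `[0, t]) (phi s * (Z w * M s w))) =
    \int[leb]_(s in `[0, t]) (phi s * \int[P]_w (Z w * M s w)).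
  apply: (expectation_integral (X := fun s w => Z w * M s w)
    (* The bound comes from [|x * y| <= x ^+ 2 + y ^+ 2] and [E[M(s)^2] <= v * t]. *)
    (C := \int[P]_w (Z w ^+ 2) + v * t) _ _ _ _ _ mphi (@bphi)).
  - by move=> s s0; apply: measurable_funM => //; exact: mM.
  - by move=> w s s0; apply: cvgM; [exact: cvg_cst|exact: rM].
  - by move=> s /andP[s0 _]; exact: iZM.
  - move=> s st; have [s0 _] := andP st.
    apply: le_trans (lerD (lexx _) (EM2_le st)).
    rewrite -(RintegralD measurableT iZ2 (iM2 s0)).
    apply: (le_Rintegral measurableT (integrable_norm (iZM s s0))
      (RintegrableD measurableT iZ2 (iM2 s0))).
    by move=> w _; exact: norm_mul_le.
  - by move=> w; apply: (RintegrableZl (measurableR_itv _)); exact: pM.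
rewrite -e1 -(RintegralD measurableT (iZM t t0) i1).
apply: eq_Rintegral => w _; rewrite /D mulrDr; congr (_ + _).
rewrite /J -(RintegralZl _ (measurableR_itv _) (pphiM w)).
by apply: eq_Rintegral => s _; rewrite mulrCA.
Qed.

Lemma volterra_mean0 : \int[P]_w D w = 0.
Proof.
have m0 s : 0 <= s -> \int[P]_w (1 * M s w) = 0.
  move=> s0; under eq_Rintegral do rewrite mul1r.
  exact: (martingale_mean0 hF hM M0).
have := @volterra_covariance (cst 1) (measurable_cst _).
rewrite /= expr1n => /(_ (finite_measure_integrable_cst _ 1 measurableT)).
have -> : \int[P]_w (1 * D w) = \int[P]_w D w.
  by apply: eq_Rintegral => w _; rewrite mul1r.
move=> ->; rewrite m0// add0r (@eq_Rintegral _ _ _ leb _ (cst 0)); last first.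
  by move=> s; rewrite inE/= in_itv/= => /andP[s0 _]; rewrite m0// mulr0.
by rewrite Rintegral_cst ?mul0r//; exact: measurableR_itv.
Qed.

Let e s := expR (xi * (t - s)).

Let e_t : e t = 1. Proof. by rewrite /e subrr mulr0 expR0. Qed.

Let volterra_cross s : 0 <= s <= t ->
  \int[P]_w (M s w * D w) =
  v * ((1 - a / xi) * s - a / xi ^+ 2 * e s + a / xi ^+ 2 * e 0).
Proof.
move=> /andP[s0 st].
rewrite (volterra_covariance (mM s0) (iM2 s0)) (martingale_covariance s0 st).
(* The covariance of [M] at [s] and [u] is [v * Num.min s u]. Its kink at [u = s] is the reason for
   splitting the integral there. *)
pose h (u : R) := (v * a * Num.min s u) * e u.
have -> : \int[leb]_(u in `[0, t]) (phi u * \int[P]_w (M s w * M u w)) =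
    \int[leb]_(u in `[0, t]) h u.
  apply: eq_Rintegral => u; rewrite inE/= in_itv/= => /andP[u0 ut].
  have -> : \int[P]_w (M s w * M u w) = v * Num.min s u.
    have [su|us] := leP s u; first exact: martingale_covariance.
    under eq_Rintegral do rewrite mulrC.
    by rewrite martingale_covariance// ltW.
  by rewrite /h /phi -/(e u); ring.
have ih : leb.-integrable `[0, t] (EFin \o h).
  apply: (bounded_Rintegrable (measurableR_itv _) (K := `|v * a * s| * expR (`|xi| * t))).
  - exact: lebesgue_itv_lty.
  - apply: measurable_funTS; apply: measurable_funM.
      by apply: measurable_funM => //; exact: measurable_minr.
    have := affine_expR_measurable 1 xi t.
    by apply: eq_measurable_fun => u _; rewrite mul1r.
  - move=> u; rewrite /= in_itv/= => ut; rewrite /h normrM; apply: ler_pM => //.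
      rewrite !normrM; apply: ler_wpM2l; first exact: mulr_ge0.
      have [u0 _] := andP ut.
      by rewrite !ger0_norm// ?ge_min ?lexx// le_min s0.
    by have := affine_expR_bound 1 xi ut; rewrite mul1r normr1 mul1r.
have := @Rintegral_itvB R h (BLeft 0) (BRight t) s ih.
rewrite !bnd_simp => /(_ s0 st) /eqP; rewrite subr_eq addrC => /eqP ->.
rewrite Rintegral_itv_obnd_cbnd; last first.
  by apply: integrableS ih => //; apply: subset_itvr; rewrite bnd_simp.
have -> : \int[leb]_(u in `[0, s]) h u =
    \int[leb]_(u in `[0, s]) ((v * a * u + 0) * e u + 0 * e u ^+ 2).
  apply: eq_Rintegral => u; rewrite inE/= in_itv/= => /andP[u0 us].
  by rewrite /h min_r// mul0r !addr0.
have -> : \int[leb]_(u in `[s, t]) h u =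
    \int[leb]_(u in `[s, t]) ((0 * u + v * a * s) * e u + 0 * e u ^+ 2).
  apply: eq_Rintegral => u; rewrite inE/= in_itv/= => /andP[su ut].
  by rewrite /h min_l// !mul0r addr0 add0r.
rewrite !Rintegral_affine_exp// -/(e s) -/(e 0) -/(e t) e_t.
by move: (e s) (e 0) => x y; field.
Qed.

(** The covariance formula with [Z = D] expresses the second moment through [E[D M(s)]], already
    known from [volterra_cross]; only integrals of [s * e s], [e s] and [e s ^+ 2] remain. *)
Lemma volterra_second_moment : \int[P]_w (D w ^+ 2) =
  v / xi ^+ 2 * ((xi - a) ^+ 2 * t + 2 * a * (xi - a) * ((expR (xi * t) - 1) / xi)
    + a ^+ 2 * ((expR (2 * xi * t) - 1) / (2 * xi))).
Proof.
have [mD iD2] := volterra_sqr_integrable.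
under eq_Rintegral do rewrite expr2.
rewrite (volterra_covariance mD iD2).
have cross s : 0 <= s <= t -> \int[P]_w (D w * M s w) =
    v * ((1 - a / xi) * s - a / xi ^+ 2 * e s + a / xi ^+ 2 * e 0).
  by move=> st; rewrite -volterra_cross//; apply: eq_Rintegral => w _; rewrite mulrC.
rewrite cross ?t0 ?lexx// e_t.
have -> : \int[leb]_(s in `[0, t]) (phi s * \int[P]_w (D w * M s w)) =
    \int[leb]_(s in `[0, t]) ((a * v * (1 - a / xi) * s + a * v * a / xi ^+ 2 * e 0) * e s
       + (- (a * v * a / xi ^+ 2)) * e s ^+ 2).
  apply: eq_Rintegral => s; rewrite inE/= in_itv/= => st; rewrite cross//.
  by rewrite /phi -/(e s); ring.
rewrite Rintegral_affine_exp// -/(e 0) -/(e t) e_t.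
have -> : expR (2 * xi * t) = e 0 ^+ 2.
  by rewrite /e subr0 -expRM_natl -mulrA.
have -> : expR (xi * t) = e 0 by rewrite /e subr0.
by move: (e 0) => x; field.
Qed.

End volterra_second_moment.

(** * Variance of the return *)

Lemma centered_variance (R : realType) (d : measure_display) (T : measurableType d)
    (P : probability T R) (X : T -> R) :
  P.-integrable setT (EFin \o (fun w => X w ^+ 2)) -> \int[P]_w X w = 0 ->
  ('V_P[X] = (\int[P]_w (X w ^+ 2))%:E)%E.
Proof.
move=> iX2 EX0.
have -> : ('V_P[X] = 'E_P[(fun w => X w ^+ 2)%R])%E.
  have m0 : fine ('E_P[X])%E = 0 by rewrite unlock; exact: EX0.
  rewrite /variance covariance.unlock m0; congr expectation.
  by apply/funext => w /=; rewrite !fctE /= !subr0 expr2.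
by rewrite unlock /Rintegral fineK//; exact: (integrable_fin_num measurableT iX2).
Qed.

Theorem proposition1 (R : realType) (d : measure_display) (T : measurableType d)
    (P : probability T R) (F : R -> set_system T)
    (mu alpha_s alpha_c beta : R)
    (hmu : 0 < mu) (hbeta : 0 < beta)
    (halpha_s : 0 <= alpha_s) (halpha_c : 0 <= alpha_c)
    (hstable : alpha_s + alpha_c < beta)
    (N1 N2 : simple_counting_process R T) (lambda1 lambda2 : R -> T -> R)
    (hmodel : symmetric_hawkes P F mu alpha_s alpha_c beta
                N1 N2 lambda1 lambda2)
    (delta S0 : R) (hdelta : 0 < delta) (hS0 : 0 < S0) :
  let lam0 := mu * beta / (beta - alpha_s - alpha_c) in
  let xi1 := - beta - alpha_c + alpha_s in
  (forall w, lambda1 0 w = lam0) ->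
  (forall w, lambda2 0 w = lam0) ->
  forall t : R, 0 <= t ->
  ('V_P[(fun w : T => ((price S0 delta N1 N2 t w - S0) / S0)%R)] =
   (2 * delta ^+ 2 * lam0 / (S0 ^+ 2 * xi1 ^+ 2)
    * (beta ^+ 2 * t
       - 2 * (alpha_s - alpha_c) * beta * ((expR (xi1 * t) - 1) / xi1)
       + (alpha_s - alpha_c) ^+ 2
         * ((expR (2 * xi1 * t) - 1) / (2 * xi1))))%:E)%E.
Proof.
move=> lam0 xi1 h1 h2 t t0.
have gap : 0 < beta - alpha_s - alpha_c by lra.
have mul0 : mu <= lam0.
  rewrite /lam0 ler_pdivlMr//; apply: (ler_wpM2l (ltW hmu)); lra.
have lam00 : 0 <= lam0 by exact: le_trans (ltW hmu) mul0.
have xi0 : xi1 != 0 by rewrite lt_eqF// /xi1; lra.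
pose M := signed_compensated N1 N2 lambda1 lambda2 (-1).
have hF := hawkes_filtration hmodel.
(* Stability makes the exponent [alpha_s + alpha_c - beta] negative, hence nonzero, and the
   stationarity relation for it is the definition of [lam0]. *)
have V s : 0 <= s -> P.-integrable setT (EFin \o total_count N1 N2 s) /\
    \int[P]_w total_count N1 N2 s w = 2 * lam0 * s.
  move=> s0; apply: (total_count_mean hmodel hbeta (ltW hmu) mul0 halpha_s halpha_c h1 h2 s0).
    by rewrite lt_eqF//; lra.
  by rewrite /lam0; field; rewrite gt_eqF.
have sqr s : 0 <= s -> P.-integrable setT (EFin \o (fun w => M s w ^+ 2)) /\
    \int[P]_w (M s w ^+ 2) = 2 * lam0 * s.
  move=> s0; rewrite -(V s s0).2.
  apply: (signed_compensated_sqr hmodel hbeta (ltW hmu) mul0 halpha_s halpha_c h1 h2 s0).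
  by move=> u u0; exact: (V u u0).1.
have nrm1 : `|(-1) : R| = 1 by rewrite normrN normr1.
have martM := signed_compensated_martingale hmodel (-1).
have rM w s : 0 <= s -> M u w @[u --> s^'+] --> M s w.
  exact: (signed_compensated_right_continuous hmodel hbeta (ltW hmu) mul0 halpha_s halpha_c h1 h2).
have bM w (r : R) : exists K : R, forall s : R, 0 <= s <= r -> `|M s w| <= K.
  eexists => s sr.
  exact: (signed_compensated_bounded hmodel hbeta (ltW hmu) mul0 halpha_s halpha_c h1 h2 w nrm1 sr).
have M0 w : M 0 w = 0 by exact: signed_compensated0.
pose a := alpha_s - alpha_c.
pose D w := M t w + \int[lebesgue_measure]_(s in `[0, t]) (a * expR (xi1 * (t - s)) * M s w).
have DE w : D w = (N1 t w)%:R - (N2 t w)%:R - ((N1 0 w)%:R - (N2 0 w)%:R).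
  have := @signed_count_representation R d T N1 N2 lambda1 lambda2 mu alpha_s alpha_c beta lam0
    hbeta (ltW hmu) mul0 halpha_s halpha_c
    (hawkes_equation1 hmodel) (hawkes_equation2 hmodel)
    (hawkes_cadlag1 hmodel) (hawkes_cadlag2 hmodel) h1 h2 (-1) t w.
  rewrite sqrrN expr1n => /(_ erefl t0); cbv zeta.
  have -> : alpha_s + -1 * alpha_c = a by rewrite mulN1r.
  have -> : a - beta = xi1 by rewrite /a /xi1; ring.
  rewrite subrr !mul0r addr0 => /(_ xi0 erefl) E.
  transitivity ((N1 t w)%:R - (N1 0 w)%:R + -1 * ((N2 t w)%:R - (N2 0 w)%:R) : R).
    exact: esym E.
  by rewrite mulN1r; ring.
have iM2 s : 0 <= s -> P.-integrable setT (EFin \o (fun w => M s w ^+ 2)).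
  by move=> s0; exact: (sqr s s0).1.
have EM2 s : 0 <= s -> \int[P]_w (M s w ^+ 2) = 2 * lam0 * s.
  by move=> s0; exact: (sqr s s0).2.
(* The variance rate [v] of the compensated difference is the total intensity [2 * lam0]. *)
have v0 : 0 <= 2 * lam0 by rewrite mulr_ge0.
have [mD iD2] := volterra_sqr_integrable hF a xi1 martM rM bM iM2 EM2 v0 t0.
have ED0 := volterra_mean0 hF a xi1 martM M0 rM bM iM2 EM2 v0 t0.
have ED2 := volterra_second_moment hF a martM rM bM iM2 EM2 v0 xi0 t0.
pose k := delta / S0.
(* From [|x| <= 1 + x ^+ 2]. *)
have iD : P.-integrable setT (EFin \o D).
  apply: (le_Rintegrable measurableT (g := fun w => 1 + D w ^+ 2)) => //.
    move=> w _; rewrite -(real_normK (num_real (D w))).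
    have := sqr_ge0 (`|D w| - 1); rewrite sqrrB expr1n mulr1 => h.
    have := normr_ge0 (D w); lra.
  by apply: (RintegrableD measurableT) => //; exact: finite_measure_integrable_cst.
have -> : (fun w => ((price S0 delta N1 N2 t w - S0) / S0)%R) = (fun w => k * D w).
  apply/funext => w; rewrite /price -DE /k; field; exact: lt0r_neq0.
have sqrE w : (k * D w) ^+ 2 = k ^+ 2 * D w ^+ 2 by rewrite exprMn.
rewrite centered_variance; last 2 first.
- apply: (eq_integrable measurableT) (RintegrableZl measurableT (k ^+ 2) iD2) => w _.
  by congr EFin; rewrite sqrE.
- by rewrite (RintegralZl _ measurableT iD) ED0 mulr0.
congr EFin; under eq_Rintegral do rewrite sqrE.
rewrite (RintegralZl _ measurableT iD2) ED2 /k.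
(* This turns the coefficients [(xi - a) ^+ 2] and [2 * a * (xi - a)] of the general formula into
   [beta ^+ 2] and [- 2 * a * beta]. *)
have -> : xi1 - a = - beta by rewrite /xi1 /a; ring.
have S00 : S0 != 0 by exact: lt0r_neq0.
rewrite /a; move: (expR _) (expR _) lam0 {h1 h2 mul0 lam00 V sqr EM2 v0 iD2 ED0 ED2} => x y l.
by field; rewrite S00 xi0.
Qed.
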